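(* For each $(q,r)\in\{(3,3),(3,4),(3,5),(3,6),(4,3),(4,4),(5,3),(6,3)\}$ let $\hat{\mathcal S}(q,r)\subset\overline{\mathbb H}^3$ be the simply truncated Coxeter orthoscheme with parallel faces with Schläfli symbol $\{\infty;q;r;\infty\}$. Consider all horoball packings of $\mathbb H^3$ with one horoball, that is, packings formed by the images, under the group generated by the reflections in the faces of $\hat{\mathcal S}(q,r)$, of one horoball $\mathcal B$ centered at an ideal vertex of $\hat{\mathcal S}(q,r)$ and admissible for $\hat{\mathcal S}(q,r)$, with density $$\frac{Vol(\mathcal B\cap\hat{\mathcal S}(q,r))}{Vol(\hat{\mathcal S}(q,r))}.$$ Then, among all these packings (over all eight pairs $(q,r)$, all ideal vertices and all admissible horoballs), the densest one is attained for $(q,r)=(3,3)$, and its density is $\approx 0.8188080$.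
   Context: Hyperbolic 3-space $\mathbb H^3$ (curvature $-1$) is modelled in Lorentz space with the form $\langle x,y\rangle=-x^0y^0+x^1y^1+x^2y^2+x^3y^3$; planes correspond to spacelike unit normals, and $\overline{\mathbb H}^3=\mathbb H^3\cup\partial\mathbb H^3$. For integers $q,r\ge 3$ with $\frac1q+\frac1r\ge\frac12$ (that is, the eight pairs listed in the claim), the simply truncated Coxeter orthoscheme with parallel faces $\hat{\mathcal S}(q,r)$, with Schläfli symbol $\{\infty;q;r;\infty\}$, is the convex polyhedron (unique up to isometry) bounded by five planes $u_0,\dots,u_4$ whose outward unit normals have Gram matrix $$\begin{pmatrix}1&-1&0&0&0\\-1&1&-\cos\frac{\pi}{q}&0&0\\0&-\cos\frac{\pi}{q}&1&-\cos\frac{\pi}{r}&0\\0&0&-\cos\frac{\pi}{r}&1&-1\\0&0&0&-1&1\end{pmatrix}.$$ Thus $u_0,u_1$ are parallel (dihedral angle $0$), $u_1,u_2$ meet at angle $\pi/q$, $u_2,u_3$ meet at angle $\pi/r$, $u_3,u_4$ are parallel, and all other pairs are perpendicular. The planes $u_0,\dots,u_3$ bound an orthoscheme with one vertex $A_3=u_0\cap u_1\cap u_2$ outside the model, and $u_4$ is the polar plane of $A_3$, truncating it. The polyhedron has finite volume, and it is a fundamental domain of the discrete group generated by the reflections in its five faces; its images tile $\mathbb H^3$. Ideal vertices: the vertex $A_2$, lying on $u_0,u_1,u_3,u_4$, is always ideal (on $\partial\mathbb H^3$); the vertex $A_0=u_1\cap u_2\cap u_3$ is ideal exactly when $(q,r)\in\{(3,6),(4,4),(6,3)\}$;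 there are no other ideal vertices. Admissible horoball: a horoball centered at an ideal vertex of $\hat{\mathcal S}(q,r)$ which does not extend beyond any face of $\hat{\mathcal S}(q,r)$ not containing its center (tangency is allowed). $Vol$ denotes hyperbolic volume (curvature $-1$). The sign $\approx$ denotes a numerical value rounded to the displayed number of decimals. *)

(* Defs.v *)
From HB Require Import structures.
From mathcomp Require Import all_boot all_order all_algebra.
From mathcomp Require Import all_classical all_reals all_analysis.

Set Implicit Arguments.
Unset Strict Implicit.
Unset Printing Implicit Defensive.

Import Order.TTheory GRing.Theory Num.Theory.
Local Open Scope classical_set_scope.
Local Open Scope ring_scope.

Definition lorentz (R : realType) (x y : 'rV[R]_4) : R :=
  - (x ord0 ord0 * y ord0 ord0)
  + \sum_(i < 3) x ord0 (lift ord0 i) * y ord0 (lift ord0 i).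

Definition hyp3 (R : realType) : set 'rV[R]_4 :=
  [set x | lorentz x x = -1 /\ 0 < x ord0 ord0].

(* The points of the boundary at infinity are the rays spanned by these
   vectors. *)
Definition light_cone (R : realType) : set 'rV[R]_4 :=
  [set p | lorentz p p = 0 /\ 0 < p ord0 ord0].

(* The hyperboloid as a graph over its space coordinates.  In this chart the
   Riemannian volume form induced by the Lorentz form is
   dx^1 dx^2 dx^3 / x^0. *)
Definition hyp3_time (R : realType) (y : R * R * R) : R :=
  Num.sqrt (1 + y.1.1 ^+ 2 + y.1.2 ^+ 2 + y.2 ^+ 2).

Definition hyp3_chart (R : realType) (y : R * R * R) : 'rV[R]_4 :=
  \row_(i < 4) nth 0 [:: hyp3_time y; y.1.1; y.1.2; y.2] i.

Definition hyp3_vol (R : realType) (A : set 'rV[R]_4) : \bar R :=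
  (\int[(@lebesgue_measure R \x @lebesgue_measure R) \x @lebesgue_measure R]_(y
     in @hyp3_chart R @^-1` A) ((hyp3_time y)^-1)%:E)%E.

Definition gram_table (R : realType) (q r : nat) : seq (seq R) :=
  let cq := cos (pi / q%:R) in
  let cr := cos (pi / r%:R) in
  [:: [::  1; -1;  0;   0;   0  ];
      [:: -1;  1; -cq;  0;   0  ];
      [::  0; -cq; 1;  -cr;  0  ];
      [::  0;  0; -cr;  1;  -1  ];
      [::  0;  0;  0;  -1;   1  ]].

Definition gram (R : realType) (q r : nat) : 'M[R]_5 :=
  \matrix_(i < 5, j < 5) nth 0 (nth [::] (gram_table R q r) i) j.

Definition polyhedron (R : realType) (u : 'I_5 -> 'rV[R]_4) : set 'rV[R]_4 :=
  [set x | hyp3 x /\ forall i, lorentz x (u i) <= 0].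

(* [u] lists the outward unit normals of a copy of the truncated orthoscheme
   {oo; q; r; oo}.  The Gram matrix determines [u] only up to the full group
   O(3,1), which contains -1; the existence of an interior point selects the
   outward normals among [u] and [- u]. *)
Definition orthoscheme (R : realType) (q r : nat) (u : 'I_5 -> 'rV[R]_4) :
    Prop :=
  (forall i j, lorentz (u i) (u j) = gram R q r i j) /\
  exists x, hyp3 x /\ forall i, lorentz x (u i) < 0.

(* The ray of [p] is a point at infinity of the closed polyhedron, and it is
   the only common point of the faces through it. *)
Definition ideal_vertex (R : realType) (u : 'I_5 -> 'rV[R]_4)
    (p : 'rV[R]_4) : Prop :=
  [/\ light_cone p,
      forall i, lorentz p (u i) <= 0 &
      forall x : 'rV[R]_4,
        (forall i, lorentz p (u i) = 0 -> lorentz x (u i) = 0) ->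
        exists c : R, x = c *: p].

(* The ray of [p] is the center; scaling [p] changes the size, so that every
   horoball is obtained from exactly one vector of the light cone. *)
Definition horoball (R : realType) (p : 'rV[R]_4) : set 'rV[R]_4 :=
  [set x | hyp3 x /\ -1 <= lorentz x p].

Definition admissible (R : realType) (u : 'I_5 -> 'rV[R]_4)
    (p : 'rV[R]_4) : Prop :=
  forall i, lorentz p (u i) != 0 ->
    horoball p `<=` [set x | lorentz x (u i) <= 0].

Definition reflection (R : realType) (n x : 'rV[R]_4) : 'rV[R]_4 :=
  x - (2 * lorentz x n) *: n.

(* Reflections are involutions: closure under composition gives the group. *)
Inductive reflection_group (R : realType) (u : 'I_5 -> 'rV[R]_4) :
    ('rV[R]_4 -> 'rV[R]_4) -> Prop :=
| reflection_group_id : reflection_group u id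
| reflection_group_comp i g :
    reflection_group u g -> reflection_group u (reflection (u i) \o g).

Definition horoball_images (R : realType) (u : 'I_5 -> 'rV[R]_4)
    (p : 'rV[R]_4) : set (set 'rV[R]_4) :=
  [set g @` horoball p | g in reflection_group u].

(* [fine] is harmless: the polyhedron has finite positive volume. *)
Definition packing_density (R : realType) (u : 'I_5 -> 'rV[R]_4)
    (p : 'rV[R]_4) : R :=
  fine (hyp3_vol (horoball p `&` polyhedron u)) / fine (hyp3_vol (polyhedron u)).

(* [P] is a packing with one horoball for (q, r), and [d] is its density. *)
Definition horoball_packing (R : realType) (q r : nat)
    (P : set (set 'rV[R]_4)) (d : R) : Prop :=
  exists (u : 'I_5 -> 'rV[R]_4) (p : 'rV[R]_4),
    [/\ orthoscheme q r u, ideal_vertex u p, admissible u p,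
        P = horoball_images u p & d = packing_density u p].

Definition orthoscheme_pairs : seq (nat * nat) :=
  [:: (3, 3); (3, 4); (3, 5); (3, 6); (4, 3); (4, 4); (5, 3); (6, 3)]%N.

(* Main.v *)
Require Import Defs.
From HB Require Import structures.
From mathcomp Require Import all_boot all_order all_algebra.
From mathcomp Require Import all_classical all_reals all_analysis.
From mathcomp Require Import measurable_realfun ring lra zify.

Set Implicit Arguments.
Unset Strict Implicit.
Unset Printing Implicit Defensive.

Import Order.TTheory GRing.Theory Num.Theory.
Import numFieldNormedType.Exports.
Local Open Scope classical_set_scope.
Local Open Scope ring_scope.

(** Put the common ideal vertex of the four faces u0, u1, u3, u4 at infinity in
the upper half space, and write a = cos (pi / q) and b = cos (pi / r), so that
1/2 <= a, b and a^2 + b^2 <= 1.  Those faces become the vertical planes x = 0,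
x = a, y = 0, y = b, and u2 becomes the unit hemisphere: the polyhedron is the
set of points above the hemisphere over the rectangle Q = [0, a] x [0, b].  Its
volume is therefore the integral over Q of dx dy / (2 (1 - x^2 - y^2)).

An admissible horoball centred at infinity must stay above height 1, the top of
the hemisphere, so it cuts off a volume of at most a b / 2 from the polyhedron.
The other possible ideal vertex is the corner (a, b) of the hemisphere, which
lies at infinity exactly when a^2 + b^2 = 1.  Seen from there, the cut-off piece
lies over a right triangle with legs along u1 and u3, the admissibility with
respect to u0 and u4 bounds its size, and the bound a b / 2 holds again
(hyp3_vol_horoball_le).

The density is thus at most the inverse of the mean of 1 / (1 - x^2 - y^2) over
Q.  Shrinking Q to the square [0, 1/2]^2 by a diagonal map brings every point
closer to the origin and so decreases this mean
(horo_volume_hemisphere_scale).  Since cos (pi / 3) = 1/2, the square is the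
rectangle of (q, r) = (3, 3), where the horoball at height 1 attains the bound.
The largest density is the inverse of 8 times the volume of that polyhedron;
the volume is enclosed by expanding 1 / (1 - s), with s = x^2 + y^2 <= 1/2, in a
geometric series and integrating its terms, which satisfy a two-term recurrence
(geometric_sandwich, radial_momentS, least_volume_bounds).

The passage from the volume dx^1 dx^2 dx^3 / x^0 of the hyperboloid chart to
these coordinates is hyp3_vol_horospherical.  The coordinates used are the
horizontal ones x, y and the inverse w of the height, which is minus the Lorentz
product with the null vector at the centre; the volume element is w dx dy dw.
Once the null vector p is fixed, the space parts of p and of two orthonormal
vectors orthogonal to p can be corrected to an orthonormal frame of R^3.  An
orthogonal change of variables, which preserves Lebesgue measure, then aligns
the last axis with p, and the one-variable substitution
w = k (sqrt (c2 + v^2) - v), for which dv / sqrt (c2 + v^2) = - dw / w, turns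
the last axis into w. *)

(** * Measurability *)

(** The inverse is discontinuous at 0; writing it as x * |x|^-2 reduces the
claim to the measurability of real powers. *)
Lemma measurable_invr (R : realType) : measurable_fun setT (fun x : R => x^-1).
Proof.
have -> : (fun x : R => x^-1) = (fun x : R => x * (x ^+ 2) `^ (-1)).
  apply/funext => x; have [->|x0] := eqVneq x 0; first by rewrite invr0 mul0r.
  by rewrite powR_inv1 ?sqr_ge0// expr2 invfM mulrA divff// mul1r.
apply: measurable_funM => //.
have mV := measurableT_comp (@measurable_powR R (-1)) (@exprn_measurable R setT 2).
exact: mV.
Qed.

Lemma measurable_sqrt (R : realType) : measurable_fun setT (@Num.sqrt R).
Proof. by apply: continuous_measurable_fun; exact: sqrt_continuous. Qed.

Section measurable_comparison.
Context d (T : measurableType d) (R : realType).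
Implicit Types f g : T -> R.

Lemma measurable_ler_set f g : measurable_fun setT f -> measurable_fun setT g ->
  measurable [set x | f x <= g x].
Proof.
move=> mf mg; have := measurable_fun_ler mf mg measurableT (Y := [set true]).
by rewrite setTI; apply.
Qed.

End measurable_comparison.

Ltac meas := repeat first
  [ exact: measurable_id | exact: measurable_cst | exact: measurable_fst
  | exact: measurable_snd | assumption
  | apply: measurable_fun_pair | apply: measurable_funD
  | apply: measurable_funB | apply: measurable_funN | apply: measurable_funM
  | apply: measurable_funX
  | apply: (measurableT_comp measurable_fst)
  | apply: (measurableT_comp measurable_snd)
  | apply: (measurableT_comp (@measurable_invr _))
  | apply: (measurableT_comp (@measurable_sqrt _)) ].

(** * Lebesgue measure on the plane and on space *)

Section lebesgue_measure_space.
Context {R : realType}.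
Local Notation mu := (@lebesgue_measure R).
Local Open Scope ereal_scope.

Definition leb2 : set (measurableTypeR R * measurableTypeR R) -> \bar R := mu \x mu.
HB.instance Definition _ := Measure.on leb2.

Let leb2_sigma_finite : sigma_finite setT leb2.
Proof.
exists (fun n => `[- n%:R, n%:R] `*` `[- n%:R, n%:R])%R.
  apply/esym; rewrite -subTset => -[x0 y0] _; pose x : R := x0; pose y : R := y0.
  have [m hm] : exists m : nat, (Num.max `|x| `|y| <= m%:R)%R.
    by exists (Num.bound (Num.max `|x| `|y|))%R; rewrite ltW// archi_boundP// le_max normr_ge0.
  exists m => //=; rewrite !in_itv/= -!ler_norml.
  by move: hm; rewrite ge_max => /andP.
move=> k; split; first exact: measurableX.
rewrite [ltLHS]product_measure1E//= lebesgue_measure_itv/=.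
by case: ifP => _; rewrite -?EFinB -?EFinM ?mule0 ltry.
Qed.
HB.instance Definition _ := Measure_isSigmaFinite.Build _ _ _ leb2 leb2_sigma_finite.

Definition leb3 : set (measurableTypeR R * measurableTypeR R * measurableTypeR R) ->
  \bar R := leb2 \x mu.
HB.instance Definition _ := Measure.on leb3.

Let leb3_sigma_finite : sigma_finite setT leb3.
Proof.
exists (fun n => (`[- n%:R, n%:R] `*` `[- n%:R, n%:R]) `*` `[- n%:R, n%:R])%R.
  apply/esym; rewrite -subTset => -[[x0 y0] z0] _.
  pose x : R := x0; pose y : R := y0; pose z : R := z0.
  have [m hm] : exists m : nat, (Num.max (Num.max `|x| `|y|) `|z| <= m%:R)%R.
    exists (Num.bound (Num.max (Num.max `|x| `|y|) `|z|))%R.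
    by rewrite ltW// archi_boundP// !le_max normr_ge0.
  exists m => //=; rewrite !in_itv/= -!ler_norml.
  by move: hm; rewrite !ge_max => /andP[/andP[]].
move=> k; split; first by apply: measurableX => //; exact: measurableX.
rewrite [ltLHS]product_measure1E//=; last exact: measurableX.
rewrite [X in X * _]product_measure1E//= lebesgue_measure_itv/=.
by case: ifP => _; rewrite -?EFinB -?EFinM ?mule0 ltry.
Qed.
HB.instance Definition _ := Measure_isSigmaFinite.Build _ _ _ leb3 leb3_sigma_finite.

Lemma lebesgue_measure_affine (k s : R) (A : set R) : (0 < k)%R -> measurable A ->
  mu ((fun x : R => k * x + s)%R @^-1` A) = k^-1%:E * mu A.
Proof.
move=> k0 mA; have k0' := ltW k0.
pose f := ((fun x : R => k * x + s)%R : measurableTypeR R -> measurableTypeR R).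
have mf : measurable_fun setT f by rewrite /f; meas.
have H (B : set R) : measurable B -> mu B = mscale (NngNum k0') (pushforward mu f) B.
  apply: lebesgue_measure_unique => _ [[a b]] _ <- /=.
  rewrite /mscale/= /pushforward/=.
  rewrite (_ : f @^-1` `]a, b] = `]((a - s) / k)%R, ((b - s) / k)%R]%classic); last first.
    apply/seteqP; split => x /=; rewrite /f !in_itv/= ltr_pdivrMr// ler_pdivlMr//;
      by rewrite [(k * _)%R]mulrC ltrBlDr lerBrDr.
  rewrite !lebesgue_measure_itv/= !lte_fin ltr_pM2r ?invr_gt0// ltrD2r.
  case: ifPn => _; last by rewrite mule0.
  rewrite -!EFinB -EFinM; congr EFin; by field; rewrite gt_eqF.
rewrite (H mf A)// /mscale/= muleA -EFinM mulVf ?gt_eqF// mul1e//.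
Qed.

Lemma integral_affine (k s : R) (F : R -> \bar R) : (0 < k)%R ->
  measurable_fun setT F -> (forall x, 0 <= F x) ->
  \int[mu]_x F (k * x + s)%R = k^-1%:E * \int[mu]_x F x.
Proof.
move=> k0 mF F0.
pose f := ((fun x : R => k * x + s)%R : measurableTypeR R -> measurableTypeR R).
have mf : measurable_fun setT f by rewrite /f; meas.
have k0' : (0 <= k^-1)%R by rewrite invr_ge0 ltW.
rewrite -(ge0_integral_mscale _ measurableT (NngNum k0'))//.
transitivity (\int[pushforward mu f]_x F x).
  by rewrite ge0_integral_pushforward// preimage_setT.
apply: eq_measure_integral => A mA _; exact: lebesgue_measure_affine.
Qed.

Lemma integral_opp (F : R -> \bar R) :
  measurable_fun setT F -> (forall x, 0 <= F x) ->
  \int[mu]_x F (- x)%R = \int[mu]_x F x.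
Proof.
move=> mF F0.
transitivity (\int[pushforward mu (-%R : measurableTypeR R -> measurableTypeR R)]_x F x).
  by rewrite ge0_integral_pushforward// preimage_setT.
apply: eq_measure_integral => A mA _; exact: lebesgue_measureN.
Qed.

Lemma leb2E (F : R * R -> \bar R) : measurable_fun setT F ->
  (forall x, 0 <= F x) -> \int[leb2]_x F x = \int[mu]_x \int[mu]_y F (x, y).
Proof. by move=> mF F0; rewrite [LHS]fubini_tonelli1. Qed.

Lemma leb3E (F : R * R * R -> \bar R) : measurable_fun setT F ->
  (forall x, 0 <= F x) ->
  \int[leb3]_v F v = \int[leb2]_v \int[mu]_z F (v, z).
Proof. by move=> mF F0; rewrite [LHS]fubini_tonelli1. Qed.

Lemma leb3E_sym (F : R * R * R -> \bar R) : measurable_fun setT F ->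
  (forall x, 0 <= F x) ->
  \int[leb3]_v F v = \int[mu]_z \int[leb2]_v F (v, z).
Proof. by move=> mF F0; rewrite [LHS]fubini_tonelli2. Qed.

Lemma measurable_integral_last (F : R * R * R -> \bar R) : measurable_fun setT F ->
  (forall x, 0 <= F x) -> measurable_fun setT (fun v : R * R => \int[mu]_z F (v, z)).
Proof. move=> mF F0; exact: (@measurable_fun_fubini_tonelli_F _ _ _ _ _ mu F). Qed.

Lemma measurable_integral_snd (F : R * R -> \bar R) : measurable_fun setT F ->
  (forall x, 0 <= F x) -> measurable_fun setT (fun x : R => \int[mu]_y F (x, y)).
Proof. move=> mF F0; exact: (@measurable_fun_fubini_tonelli_F _ _ _ _ _ mu F). Qed.

Lemma leb2_affine (k1 k2 s1 s2 : R) (F : R * R -> \bar R) :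
  (0 < k1)%R -> (0 < k2)%R -> measurable_fun setT F -> (forall x, 0 <= F x) ->
  \int[leb2]_v F (k1 * v.1 + s1, k2 * v.2 + s2)%R =
  (k1 * k2)^-1%:E * \int[leb2]_v F v.
Proof.
move=> k1_gt0 k2_gt0 mF F0.
rewrite leb2E//; last first.
  by apply: (measurableT_comp mF); meas.
rewrite leb2E//.
under eq_integral => x _.
  rewrite (@integral_affine _ _ (fun y => F (k1 * x + s1, y)%R))//; last first.
    apply: (measurableT_comp mF); meas.
  over.
have mG := measurable_integral_snd mF F0.
have G0 x : 0 <= \int[mu]_y F (x, y) by exact: integral_ge0.
rewrite ge0_integralZl ?lee_fin ?invr_ge0 ?ltW//; last first.
  apply: (@measurableT_comp _ _ _ _ _ _ (fun x => \int[mu]_y F (x, y)) _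
    (fun x : R => k1 * x + s1)%R) => //.
  by meas.
rewrite (@integral_affine _ _ (fun x => \int[mu]_y F (x, y)))//.
by rewrite muleA -EFinM invfM mulrC.
Qed.

Lemma leb3_affine (k1 k2 k3 s1 s2 s3 : R) (F : R * R * R -> \bar R) :
  (0 < k1)%R -> (0 < k2)%R -> (0 < k3)%R ->
  measurable_fun setT F -> (forall x, 0 <= F x) ->
  \int[leb3]_v F ((k1 * v.1.1 + s1, k2 * v.1.2 + s2), k3 * v.2 + s3)%R =
  (k1 * k2 * k3)^-1%:E * \int[leb3]_v F v.
Proof.
move=> k1_gt0 k2_gt0 k3_gt0 mF F0.
rewrite leb3E//; last first.
  by apply: (measurableT_comp mF); meas.
rewrite leb3E//.
under eq_integral => x _.
  rewrite (@integral_affine _ _ (fun y => F (k1 * x.1 + s1, k2 * x.2 + s2, y)%R))//; last first.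
    apply: (measurableT_comp mF); meas.
  over.
have mG := measurable_integral_last mF F0.
have G0 x : 0 <= \int[mu]_y F (x, y) by exact: integral_ge0.
rewrite ge0_integralZl ?lee_fin ?invr_ge0 ?ltW//; last first.
  apply: (@measurableT_comp _ _ _ _ _ _ (fun x => \int[mu]_y F (x, y)) _
    (fun x : R*R => (k1 * x.1 + s1, k2 * x.2 + s2))%R) => //.
  by meas.
rewrite (@leb2_affine _ _ _ _ (fun x => \int[mu]_y F (x, y)))//.
by rewrite muleA -EFinM !invfM mulrC.
Qed.

Lemma leb2_opp (F : R * R -> \bar R) :
  measurable_fun setT F -> (forall x, 0 <= F x) ->
  \int[leb2]_v F (- v.1, - v.2)%R = \int[leb2]_v F v.
Proof.
move=> mF F0.
have mG := measurable_integral_snd mF F0.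
have G0 x : 0 <= \int[mu]_y F (x, y) by exact: integral_ge0.
rewrite leb2E//; last first.
  by apply: (measurableT_comp mF); meas.
rewrite leb2E//.
under eq_integral => x _.
  rewrite (@integral_opp (fun y => F (- x, y)%R))//; last first.
    apply: (measurableT_comp mF); meas.
  over.
by rewrite (@integral_opp (fun x => \int[mu]_y F (x, y))).
Qed.

Lemma leb3_opp (F : R * R * R -> \bar R) :
  measurable_fun setT F -> (forall x, 0 <= F x) ->
  \int[leb3]_v F ((- v.1.1, - v.1.2), - v.2)%R = \int[leb3]_v F v.
Proof.
move=> mF F0.
have mG := measurable_integral_last mF F0.
have G0 x : 0 <= \int[mu]_y F (x, y) by exact: integral_ge0.
rewrite leb3E//; last first.
  by apply: (measurableT_comp mF); meas.
rewrite leb3E//.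
under eq_integral => x _.
  rewrite (@integral_opp (fun y => F (- x.1, - x.2, y)%R))//; last first.
    apply: (measurableT_comp mF); meas.
  over.
by rewrite (@leb2_opp (fun x => \int[mu]_y F (x, y))).
Qed.

Lemma leb3_translate (c : R * R * R) (F : R * R * R -> \bar R) :
  measurable_fun setT F -> (forall x, 0 <= F x) ->
  \int[leb3]_v F (v + c)%R = \int[leb3]_v F v.
Proof.
move=> mF F0.
rewrite -[RHS]mul1e -[X in X%:E * _](_ : (1 * 1 * 1)^-1 = 1)%R; last by rewrite !mulr1 invr1.
rewrite -(@leb3_affine 1 1 1 c.1.1 c.1.2 c.2)//.
by under [RHS]eq_integral do rewrite !mul1r.
Qed.

Lemma measurable_addc (c : R * R * R) : measurable_fun setT (fun v : R * R * R => v + c)%R.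
Proof.
have h : measurable_fun setT (fun v : R * R * R =>
  ((v.1.1 + c.1.1, v.1.2 + c.1.2), v.2 + c.2))%R by meas.
exact: h.
Qed.

Lemma leb3_reflect (c : R * R * R) (F : R * R * R -> \bar R) :
  measurable_fun setT F -> (forall x, 0 <= F x) ->
  \int[leb3]_v F (c - v)%R = \int[leb3]_v F v.
Proof.
move=> mF F0; rewrite -(leb3_translate c mF F0).
rewrite -[RHS](@leb3_opp (fun v => F (v + c)%R))//.
  by apply: eq_integral => v _; rewrite addrC.
by apply: (measurableT_comp mF); exact: measurable_addc.
Qed.

Section weil.
Variables T T' : R * R * R -> R * R * R.
Hypothesis mT : measurable_fun setT T.
Hypothesis TD : forall v w, T (v + w)%R = (T v + T w)%R.
Hypothesis T'K : cancel T' T.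

(** The uniqueness argument for Haar measure: both sides equal the double
integral of F (T x) * g (y + T x), the right one by the reflection
y |-> T x - y and then the translation by T' y in x.  When the integral of g is
positive, finite and invariant under T, the same invariance follows for every F. *)
Lemma leb3_weil (F g : R * R * R -> \bar R) :
  measurable_fun setT F -> (forall x, 0 <= F x) ->
  measurable_fun setT g -> (forall x, 0 <= g x) ->
  (\int[leb3]_v F (T v)) * (\int[leb3]_v g v) =
  (\int[leb3]_v g (T v)) * (\int[leb3]_v F v).
Proof.
move=> mF F0 mg g0.
have mFT : measurable_fun setT (fun v => F (T v)) by exact: (measurableT_comp mF).
have mgT : measurable_fun setT (fun v => g (T v)) by exact: (measurableT_comp mg).
rewrite -ge0_integralZr//; last exact: integral_ge0.
rewrite -ge0_integralZr//; last exact: integral_ge0.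
have mT1 : measurable_fun setT (fun p : (R * R * R) * (R * R * R) => T p.1).
  exact: (measurableT_comp mT).
have mgD : measurable_fun setT
    (fun p : (R * R * R) * (R * R * R) => g (p.2 + T p.1)%R).
  apply: (measurableT_comp mg).
  have h : measurable_fun setT (fun p : (R * R * R) * (R * R * R) =>
    ((p.2.1.1 + (T p.1).1.1, p.2.1.2 + (T p.1).1.2), p.2.2 + (T p.1).2)%R) by meas.
  exact: h.
have mFB : measurable_fun setT
    (fun p : (R * R * R) * (R * R * R) => F (T p.1 - p.2)%R).
  apply: (measurableT_comp mF).
  have h : measurable_fun setT (fun p : (R * R * R) * (R * R * R) =>
    (((T p.1).1.1 - p.2.1.1, (T p.1).1.2 - p.2.1.2), (T p.1).2 - p.2.2)%R) by meas.
  exact: h.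
have mF1 : measurable_fun setT (fun p : (R * R * R) * (R * R * R) => F (T p.1)).
  exact: (measurableT_comp mF).
have mg1 : measurable_fun setT (fun p : (R * R * R) * (R * R * R) => g (T p.1)).
  exact: (measurableT_comp mg).
transitivity (\int[leb3]_x \int[leb3]_y (F (T x) * g (y + T x)%R)).
  apply: eq_integral => x _.
  by rewrite -(leb3_translate (T x) mg g0) ge0_integralZl//;
    apply: (measurableT_comp mg); exact: measurable_addc.
transitivity (\int[leb3]_y \int[leb3]_x (F (T x) * g (y + T x)%R)).
  pose K (p : (R * R * R) * (R * R * R)) := F (T p.1) * g (p.2 + T p.1)%R.
  apply: (@fubini_tonelli _ _ _ _ _ leb3 leb3 K).
    exact: emeasurable_funM.
  by move=> p; exact: mule_ge0.
transitivity (\int[leb3]_y \int[leb3]_x (F (T x - y)%R * g (T x))).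
  apply: eq_integral => y _.
  (* by additivity and T (T' y) = y, the shift by T' y of x shifts T x by y *)
  rewrite -[RHS](leb3_translate (T' y)); last 2 first.
  - apply: emeasurable_funM => //.
    exact: (measurableT_comp mFB (pair2_measurable y)).
  - by move=> x; exact: mule_ge0.
  by apply: eq_integral => x _; rewrite TD T'K addrK addrC.
transitivity (\int[leb3]_x \int[leb3]_y (F (T x - y)%R * g (T x))).
  pose K (p : (R * R * R) * (R * R * R)) := F (T p.1 - p.2)%R * g (T p.1).
  apply/esym; apply: (@fubini_tonelli _ _ _ _ _ leb3 leb3 K).
    exact: emeasurable_funM.
  by move=> p; exact: mule_ge0.
apply: eq_integral => x _.
rewrite ge0_integralZr//; last by have := measurableT_comp mFB (pair1_measurable x).
by rewrite leb3_reflect// muleC.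
Qed.
End weil.

Definition dot3 (v w : R * R * R) : R := (v.1.1 * w.1.1 + v.1.2 * w.1.2 + v.2 * w.2)%R.

(** A square matrix whose rows are orthonormal has orthonormal columns, because
a right inverse is a left inverse. *)
Lemma orthonormal_columns (a1 a2 a3 b1 b2 b3 c1 c2 c3 : R) :
  let a := ((a1, a2), a3) in let b := ((b1, b2), b3) in let c := ((c1, c2), c3) in
  dot3 a a = 1%R -> dot3 b b = 1%R -> dot3 c c = 1%R ->
  dot3 a b = 0%R -> dot3 a c = 0%R -> dot3 b c = 0%R ->
  let a' := ((a1, b1), c1) in let b' := ((a2, b2), c2) in let c' := ((a3, b3), c3) in
  [/\ dot3 a' a' = 1%R, dot3 b' b' = 1%R, dot3 c' c' = 1%R &
    [/\ dot3 a' b' = 0%R, dot3 a' c' = 0%R & dot3 b' c' = 0%R] ].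
Proof.
rewrite /dot3/= => aa bb cc ab ac bc.
pose M : 'M[R]_3 := (\matrix_(i < 3, j < 3)
  nth 0%R (nth [::] [:: [:: a1; a2; a3]; [:: b1; b2; b3]; [:: c1; c2; c3]] i) j)%R.
have MMT : (M *m M^T)%R = 1%:M%R.
  apply/matrixP => i j; rewrite !mxE !big_ord_recl big_ord0 !mxE/=.
  case: i => [[|[|[|//]]] ?]; case: j => [[|[|[|//]]] ?];
    rewrite /= addr0 addrA; first [done|by rewrite 1?(mulrC b1 a1) 1?(mulrC b2 a2)
      1?(mulrC b3 a3)
      1?(mulrC c1 a1) 1?(mulrC c2 a2) 1?(mulrC c3 a3)
      1?(mulrC c1 b1) 1?(mulrC c2 b2) 1?(mulrC c3 b3)].
have /matrixP H := mulmx1C MMT.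
have E i j := H i j.
have e00 := H ord0 ord0. have e11 := H (inord 1) (inord 1). have e22 := H (inord 2) (inord 2).
have e01 := H ord0 (inord 1). have e02 := H ord0 (inord 2). have e12 := H (inord 1) (inord 2).
move: e00 e11 e22 e01 e02 e12.
rewrite !mxE !big_ord_recl !big_ord0 !mxE/= -!val_eqE/= !inordK//= !addr0 !addrA.
by move=> *; split => //; split.
Qed.

Section orthogonal.
Variables a b c : R * R * R.
Hypotheses (aa : dot3 a a = 1%R) (bb : dot3 b b = 1%R) (cc : dot3 c c = 1%R).
Hypotheses (ab : dot3 a b = 0%R) (ac : dot3 a c = 0%R) (bc : dot3 b c = 0%R).

Lemma dot3_frame v : ((dot3 a v) ^+ 2 + (dot3 b v) ^+ 2 + (dot3 c v) ^+ 2 = dot3 v v)%R.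
Proof.
move: a b c aa bb cc ab ac bc => [[a1 a2] a3] [[b1 b2] b3] [[c1 c2] c3] *.
have [] := @orthonormal_columns a1 a2 a3 b1 b2 b3 c1 c2 c3 => //.
case: v => [[x y] z]; rewrite /dot3/= => e1 e2 e3 [e4 e5 e6].
transitivity ((a1 * a1 + b1 * b1 + c1 * c1) * x ^+ 2 + (a2 * a2 + b2 * b2 + c2 * c2) * y ^+ 2 +
 (a3 * a3 + b3 * b3 + c3 * c3) * z ^+ 2 + 2 * ((a1 * a2 + b1 * b2 + c1 * c2) * (x * y)
 + (a1 * a3 + b1 * b3 + c1 * c3) * (x * z) + (a2 * a3 + b2 * b3 + c2 * c3) * (y * z)))%R.
  ring.
by rewrite e1 e2 e3 e4 e5 e6; ring.
Qed.

(** The indicator of the unit ball is invariant under orthogonal maps, and its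
integral is positive and finite, so leb3_weil applies with it. *)
Lemma leb3_orthogonal (F : R * R * R -> \bar R) :
  measurable_fun setT F -> (forall x, 0 <= F x) ->
  \int[leb3]_v F ((dot3 a v, dot3 b v), dot3 c v) = \int[leb3]_v F v.
Proof.
move=> mF F0.
pose T v := ((dot3 a v, dot3 b v), dot3 c v).
pose T' (w : R * R * R) := ((a.1.1 * w.1.1 + b.1.1 * w.1.2 + c.1.1 * w.2,
                a.1.2 * w.1.1 + b.1.2 * w.1.2 + c.1.2 * w.2),
                a.2 * w.1.1 + b.2 * w.1.2 + c.2 * w.2)%R.
have mT : measurable_fun setT T by rewrite /T /dot3; meas.
have TD v w : T (v + w)%R = (T v + T w)%R.
  by rewrite /T /dot3/=; congr (_, _, _) => /=; ring.
have T'K : cancel T' T.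
  move=> [[x y] z]; rewrite /T /T'/=; congr (_, _, _).
  - transitivity (dot3 a a * x + dot3 a b * y + dot3 a c * z)%R; first by rewrite /dot3/=; ring.
    by rewrite aa ab ac; ring.
  - transitivity (dot3 a b * x + dot3 b b * y + dot3 b c * z)%R; first by rewrite /dot3/=; ring.
    by rewrite bb ab bc; ring.
  - transitivity (dot3 a c * x + dot3 b c * y + dot3 c c * z)%R; first by rewrite /dot3/=; ring.
    by rewrite cc ac bc; ring.
pose B : set (R * R * R) := [set v | dot3 v v <= 1]%R.
have mB : measurable B.
  by apply: measurable_ler_set => //; rewrite /dot3; meas.
have mg : measurable_fun setT (fun v : R * R * R => (\1_B v)%:E : \bar R).
  by apply/measurable_EFinP; exact: measurable_indic.
have g0 v : 0 <= ((\1_B v : R)%:E : \bar R) by rewrite lee_fin.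
have := leb3_weil mT TD T'K mF F0 mg g0.
rewrite [X in _ = X * _](_ : _ = \int[leb3]_v (\1_B v)%:E); last first.
  apply: eq_integral => v _; rewrite !indicE; congr (_%:R%:E).
  suff BT : (B (T v)) = B v by congr nat_of_bool; rewrite /in_mem/= /in_set BT.
  by rewrite /B/= -(dot3_frame v) /T {1}/dot3/= -!expr2.
rewrite integral_indic// setIT.
(* the ball contains the cube of side 1/2 and is contained in one of side 2 *)
have Bpos : 0 < leb3 B.
  pose C : set (R * R * R) := ((`[0, 2^-1] `*` `[0, 2^-1]) `*` `[0, 2^-1])%R.
  have mC : measurable C by apply: measurableX => //; exact: measurableX.
  apply: (@lt_le_trans _ _ (leb3 C)).
    rewrite [ltRHS]product_measure1E//=; last exact: measurableX.
    rewrite [X in X * _]product_measure1E//= lebesgue_measure_itv/= lte_fin.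
    by rewrite invr_gt0 ltr0n -EFinB -!EFinM lte_fin subr0 !mulr_gt0// invr_gt0.
  apply: le_measure; rewrite ?inE// => -[[x y] z] [[]]/=.
  rewrite !in_itv/= /B/= /dot3/= => /andP[x0 x1] /andP[y0 y1] /andP[z0 z1].
  nra.
have Bfin : leb3 B < +oo.
  pose C : set (R * R * R) := ((`[-1, 1] `*` `[-1, 1]) `*` `[-1, 1])%R.
  have mC : measurable C by apply: measurableX => //; exact: measurableX.
  apply: (@le_lt_trans _ _ (leb3 C)); last first.
    rewrite [ltLHS]product_measure1E//=; last exact: measurableX.
    rewrite [X in X * _]product_measure1E//= lebesgue_measure_itv/= lte_fin.
    by case: ifP => _; rewrite -?EFinB -?EFinM ?mule0 ltry.
  apply: le_measure; rewrite ?inE// => -[[x y] z].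
  rewrite /B/C/= /dot3/= => h; rewrite !in_itv/=.
  by split; [split|]; apply/andP; split; nra.
have Bf : leb3 B \is a fin_num by rewrite ge0_fin_numE// ltW.
by rewrite muleC => /eqP; rewrite eq_le !lee_pmul2l// -eq_le => /eqP.
Qed.
End orthogonal.

End lebesgue_measure_space.

(** * A logarithmic substitution *)

Section density.
Local Open Scope ereal_scope.
Context d (T : measurableType d) (R : realType) (mu : {measure set T -> \bar R}).
Variable f : T -> \bar R.
Hypotheses (mf : measurable_fun setT f) (f0 : forall x, 0 <= f x).

Definition density (A : set T) := \int[mu]_(x in A) f x.

Let density0 : density set0 = 0.
Proof. exact: integral_set0. Qed.

Let density_ge0 A : 0 <= density A.
Proof. exact: integral_ge0. Qed.

Let density_sigma_additive : semi_sigma_additive density.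
Proof. exact: semi_sigma_additive_nng_induced. Qed.

(** The density as a structured measure, so that uniqueness theorems for
measures apply to it. *)
Definition density_measure : {measure set T -> \bar R} :=
  HB.pack density (isMeasure.Build _ _ _ density density0 density_ge0 density_sigma_additive).

End density.

Lemma ocitv_measure_unique (R : realType)
    (m1 m2 : {measure set (measurableTypeR R) -> \bar R}) :
  (forall a b : R, m1 `]a, b]%classic = m2 `]a, b]%classic) ->
  (forall a b : R, m1 `]a, b]%classic < +oo)%E ->
  forall A : set (measurableTypeR R), measurable A -> m1 A = m2 A.
Proof.
move=> m12 m1oo A mA.
apply: (@measure_unique _ _ (measurableTypeR R) (@ocitv R) (fun n => `](- n%:R)%R,
  n%:R%R]%classic)) => //.
- exact: ocitvI.
- by move=> i; exact: is_ocitv.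
- exact: (@bigcup_itvT R false false).
- by move=> _ [[a b]] _ <-; exact: m12.
Qed.

Section log_substitution.
Context {R : realType}.
Local Notation mu := (@lebesgue_measure R).
Variables c2 k : R.
Hypotheses (c2_gt0 : 0 < c2) (k_gt0 : 0 < k).

Let psi (w : R) : R := (c2 * k * w^-1 - w / k) / 2.
Let phi (v : R) : R := k * (Num.sqrt (c2 + v ^+ 2) - v).
Let g (v : R) : R := (Num.sqrt (c2 + v ^+ 2))^-1.

Let radicand_gt0 v : 0 < c2 + v ^+ 2.
Proof. by rewrite ltr_wpDr ?sqr_ge0. Qed.

Let phi_gt0 v : 0 < phi v.
Proof.
rewrite /phi mulr_gt0// subr_gt0 (le_lt_trans (ler_norm v))//.
by rewrite -sqrtr_sqr ltr_sqrt// ltrDr.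
Qed.

Let sqrt_psi (w : R) : 0 < w -> Num.sqrt (c2 + psi w ^+ 2) = (c2 * k * w^-1 + w / k) / 2.
Proof.
move=> w0; rewrite (_ : c2 + _ = ((c2 * k * w^-1 + w / k) / 2) ^+ 2); last first.
  by rewrite /psi; field; rewrite !gt_eqF.
rewrite sqrtr_sqr ger0_norm// divr_ge0// addr_ge0// ?divr_ge0 ?ltW//.
by rewrite !mulr_gt0 ?invr_gt0.
Qed.

Let psiK (w : R) : 0 < w -> phi (psi w) = w.
Proof. by move=> w0; rewrite /phi sqrt_psi// /psi; field; rewrite !gt_eqF. Qed.

Let phiK v : psi (phi v) = v.
Proof.
have := sqr_sqrtr (ltW (radicand_gt0 v)).
have := phi_gt0 v; rewrite /psi /phi.
set s := Num.sqrt _ => p0 s2.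
have sv0 : s - v != 0 by move: p0; rewrite pmulr_rgt0// => /gt_eqF ->.
have -> : c2 = s ^+ 2 - v ^+ 2 by rewrite s2; ring.
by field; rewrite sv0 gt_eqF.
Qed.

Let psi_decr (x y : R) : 0 < x -> x < y -> psi y < psi x.
Proof.
move=> x0 xy; have y0 := lt_trans x0 xy.
rewrite /psi ltr_pM2r// ltrB// ?ltr_pM2l ?mulr_gt0// ?ltf_pV2//.
by rewrite ltr_pM2r// invr_gt0.
Qed.

Let psi_lt (x y : R) : 0 < x -> 0 < y -> (psi y < psi x) = (x < y).
Proof.
move=> x0 y0; apply/idP/idP; last exact: psi_decr.
apply: contraTT; rewrite -!leNgt le_eqVlt => /predU1P[->//|yx].
by apply/ltW/psi_decr.
Qed.

Let is_derive_psi (w : R) : 0 < w -> is_derive w 1 psi (- (c2 * k * w^-2 + k^-1) / 2).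
Proof.
move=> w0; have w_neq0 : w != 0 by rewrite gt_eqF.
have D := @is_deriveV _ id w 1 1 w_neq0 (is_derive_id _ _).
rewrite (_ : psi = 2^-1 *: ((c2 * k) *: (fun x : R => (id x)^-1) - k^-1 *: id)); last first.
  by apply/funext => x; rewrite /psi !fctE /GRing.scale/=; ring.
apply: is_derive_eq; rewrite /GRing.scale/=.
by field; rewrite w_neq0 gt_eqF.
Qed.

(** The substitution is applied to psi, the inverse of phi: for w > 0 it is
given by a rational function, and psi' (w) = - sqrt (c2 + psi w ^ 2) / w. *)
Lemma integral_inv_sqrt_itv (x y : R) : 0 < x -> x < y ->
  (\int[mu]_(v in `[psi y, psi x]) (g v)%:E = \int[mu]_(w in `[x, y]) (w^-1)%:E)%E.
Proof.
move=> x0 xy.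
have d1 (w : R) : 0 < w -> (derive1 psi) w = - (c2 * k * w^-2 + k^-1) / 2.
  by move=> w0; rewrite derive1E; have [] := is_derive_psi w0.
have cd1 (z : R) : 0 < z -> {for z, continuous (derive1 psi)}.
  move=> z0.
  have H : - (c2 * k * w^-2 + k^-1) / 2 @[w --> z] --> - (c2 * k * z^-2 + k^-1) / 2.
    apply: cvgM; last exact: cvg_cst.
    apply: cvgN; apply: cvgD; last exact: cvg_cst.
    apply: cvgM; first exact: cvg_cst.
    apply: cvgV; first by rewrite expf_neq0// gt_eqF.
    exact: exprn_continuous.
  rewrite /prop_for /continuous_at d1//; apply: cvg_trans H.
  apply: near_eq_cvg; near=> w; rewrite d1//; near: w; exact: lt_nbhsr.
have cpsi (z : R) : 0 < z -> {for z, continuous psi}.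
  move=> z0; apply: differentiable_continuous; apply/derivable1_diffP.
  by have [] := is_derive_psi z0.
have y0 := lt_trans x0 xy.
rewrite (@integration_by_substitution_decreasing _ psi g x y (ltW xy)).
- apply: eq_integral => w; rewrite inE/= in_itv/= => /andP[xw _].
  have w0 := lt_le_trans x0 xw.
  rewrite !fctE /= /g sqrt_psi// d1//; congr EFin.
  have h : 0 < c2 * k * k + w * w by rewrite addr_gt0 ?mulr_gt0.
  by field; rewrite !gt_eqF.
- move=> a b; rewrite !in_itv/= => /andP[xa _] /andP[xb _] ab.
  exact: psi_decr (lt_le_trans x0 xb) ab.
- by move=> z; rewrite in_itv/= => /andP[xz _]; apply: cd1; exact: lt_trans xz.
- by apply/cvg_ex; exists ((derive1 psi) x); apply: cvg_at_right_filter; exact: cd1.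
- by apply/cvg_ex; exists ((derive1 psi) y); apply: cvg_at_left_filter; exact: cd1.
- split.
  + move=> z; rewrite in_itv/= => /andP[xz _].
    by have [] := is_derive_psi (lt_trans x0 xz).
  + by apply: cvg_at_right_filter; exact: cpsi.
  + by apply: cvg_at_left_filter; exact: cpsi.
- apply: continuous_subspaceT => v; apply: cvgV.
    by rewrite gt_eqF// sqrtr_gt0.
  apply: continuous_cvg; first exact: sqrt_continuous.
  apply: cvgD; first exact: cvg_cst.
  exact: exprn_continuous.
Unshelve. all: by end_near. Qed.

Let h (w : R) : \bar R := (if 0 < w then w^-1 else 0)%:E.

Let mg : measurable_fun setT (fun v => (g v)%:E).
Proof.
by apply/measurable_EFinP; rewrite /g; meas.
Qed.

Let mh : measurable_fun setT h.
Proof.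
apply/measurable_EFinP; apply: measurable_fun_ifT => //; first exact: measurable_fun_ltr.
exact: measurable_invr.
Qed.

Let mpsi : measurable_fun setT psi. Proof. rewrite /psi; meas. Qed.
Let mphi : measurable_fun setT phi.
Proof.
by rewrite /phi; meas.
Qed.

(** The two sides are measures of C that agree on bounded intervals by the
previous lemma; phi maps the line bijectively onto the
positive reals. *)
Lemma integral_inv_sqrt (C : set R) : measurable C ->
  (\int[mu]_v ((\1_C (phi v) * g v)%:E) = \int[mu]_(w in C) h w)%E.
Proof.
move=> mC.
have g0 v : (0 <= (g v)%:E)%E by rewrite lee_fin invr_ge0 sqrtr_ge0.
have h0 v : (0 <= h v)%E by rewrite lee_fin; case: ifPn => // /ltW; rewrite invr_ge0.
pose m1 := density_measure mu mg g0.
pose m2' := density_measure mu mh h0.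
pose psi' : measurableTypeR R -> measurableTypeR R := psi.
have mpsi' : measurable_fun setT psi' by exact: mpsi.
have eqm : forall B : set (measurableTypeR R), measurable B ->
    m1 B = pushforward m2' psi' B.
  apply: ocitv_measure_unique => [a b|a b].
    rewrite /= /pushforward /density.
    have [ab|ba] := ltP a b; last first.
      rewrite (_ : `]a, b]%classic = set0) ?preimage_set0 ?integral_set0//.
      by apply/seteqP; split => // x; rewrite /= in_itv/= =>
        /andP[/lt_le_trans /[apply]]; rewrite ltNge ba.
    have phi_decr : phi b < phi a by rewrite -psi_lt// !phiK.
    transitivity (\int[mu]_(v in `[psi (phi a), psi (phi b)]) (g v)%:E)%E.
      rewrite !phiK; apply: integral_itv_obnd_cbnd.
      exact: measurable_funTS.
    rewrite integral_inv_sqrt_itv//.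
    transitivity (\int[mu]_(w in `[phi b, phi a[) (w^-1)%:E)%E.
      apply/esym; apply: integral_itv_bndo_bndc.
      apply: measurable_funTS; apply/measurable_EFinP; exact: measurable_invr.
    rewrite [LHS]integral_mkcond [RHS]integral_mkcond; apply: eq_integral => w _.
    rewrite /patch; have [w0|w0] := ltP 0 w; last first.
      rewrite memNset/=; last by rewrite in_itv/= leNgt (le_lt_trans w0).
      by case: ifP => //; rewrite /h ltNge w0.
    rewrite [in RHS]/h w0; congr (if _ then _ else _); apply/idP/idP; rewrite !inE/= !in_itv/=.
      by rewrite /psi' -{2}(phiK a) -{2}(phiK b) psi_lt// !leNgt psi_lt// andbC.
    by rewrite /psi' -{1}(phiK a) -{1}(phiK b) psi_lt// !leNgt psi_lt// andbC.
  rewrite /= /density.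
  apply: (@le_lt_trans _ _ (\int[mu]_(x in `]a, b]) (Num.sqrt c2)^-1%:E)%E).
    apply: ge0_le_integral => //.
    - exact: measurable_funTS.
    - move=> x _; rewrite lee_fin /g lef_pV2 ?posrE ?sqrtr_gt0// ler_sqrt; last exact: ltW.
      by rewrite lerDl sqr_ge0.
  rewrite [ltLHS](integral_cst mu (D := `]a, b]%classic) _ (Num.sqrt c2)^-1%:E)//.
  rewrite [X in (_ * X)%E](@lebesgue_measure_itv R `]a, b]%R)/=; case: ifP => _;
    last by rewrite mule0 ltry.
  by rewrite -EFinB -EFinM ltry.
have mB : measurable (phi @^-1` C) by rewrite -[X in measurable X]setTI; exact: mphi.
transitivity (m1 (phi @^-1` C)).
  rewrite /m1/= /density [RHS]integral_mkcond; apply: eq_integral => v _.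
  rewrite /patch indicE (_ : (v \in phi @^-1` C) = (phi v \in C));
    last by apply/idP/idP; rewrite !inE.
  by case: ifP => _; rewrite ?mul1r ?mul0r.
rewrite eqm// /= /pushforward /density.
rewrite [LHS]integral_mkcond [RHS]integral_mkcond; apply: eq_integral => w _.
rewrite /patch /h; have [w0|w0] := ltP 0 w; last by case: ifP; case: ifP.
rewrite (_ : (w \in psi' @^-1` (phi @^-1` C)) = (w \in C))//.
by apply/idP/idP; rewrite !inE/= psiK.
Qed.

End log_substitution.

(** * Hyperbolic volume in horospherical coordinates *)

Section lorentz_coordinates.
Context {R : realType}.
Implicit Types x y p : 'rV[R]_4.

Definition time x : R := x ord0 ord0.
Definition space x : R * R * R :=
  (x ord0 (lift ord0 ord0), x ord0 (lift ord0 (lift ord0 ord0)), x ord0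
    (lift ord0 (lift ord0 (lift ord0 ord0)))).

Lemma hyp3_volE (A : set 'rV[R]_4) :
  hyp3_vol A = (\int[leb3]_(y in @hyp3_chart R @^-1` A) ((hyp3_time y)^-1)%:E)%E.
Proof. by []. Qed.

Lemma lorentzE x y : lorentz x y = dot3 (space x) (space y) - time x * time y.
Proof.
by rewrite /lorentz !big_ord_recl big_ord0 /dot3 /time/=; ring.
Qed.

Lemma time_hyp3_chart v : time (hyp3_chart v) = Num.sqrt (1 + dot3 v v).
Proof. by rewrite /time mxE/= /hyp3_time /dot3 !expr2 !addrA. Qed.

Lemma space_hyp3_chart v : space (hyp3_chart v) = v.
Proof. by case: v => [[a b] c]; rewrite /space !mxE. Qed.

End lorentz_coordinates.

Section horospherical_volume.
Context {R : realType}.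
Local Notation mu := (@lebesgue_measure R).

(** In the upper half space with height z = 1 / w, the volume element
dx dy dz / z^3 is w dx dy dw on w > 0. *)
Definition horo_density (E : set (R * R * R)) (v : R * R * R) : \bar R :=
  (if 0 < v.2 then \1_E v * v.2 else 0)%:E.

Definition horo_volume (E : set (R * R * R)) : \bar R :=
  (\int[leb3]_v horo_density E v)%E.

Lemma measurable_horo_density (E : set (R * R * R)) : measurable E ->
  measurable_fun setT (horo_density E).
Proof.
move=> mE; apply/measurable_EFinP; apply: measurable_fun_ifT => //.
  by apply: measurable_fun_ltr.
by apply: measurable_funM => //; exact: measurable_indic.
Qed.

Lemma horo_density_ge0 E v : (0 <= horo_density E v)%E.
Proof. by rewrite lee_fin; case: ifPn => // v0; rewrite mulr_ge0// ltW. Qed.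

Variables p e f : 'rV[R]_4.
Hypotheses (pp : lorentz p p = 0) (p0 : 0 < time p).
Hypotheses (ee : lorentz e e = 1) (ff : lorentz f f = 1) (ef : lorentz e f = 0).
Hypotheses (ep : lorentz e p = 0) (fp : lorentz f p = 0).

(** Horospherical coordinates centred at the ray of p: the horizontal
coordinates along e and f, and the inverse of the height. *)
Definition horo_coord (x : 'rV[R]_4) : R * R * R :=
  (lorentz x e / - lorentz x p, lorentz x f / - lorentz x p, - lorentz x p).

Let dot3C (v w : R * R * R) : dot3 v w = dot3 w v.
Proof. by rewrite /dot3; ring. Qed.

Let sub (v w : R * R * R) (t : R) : R * R * R :=
  (v.1.1 - t * w.1.1, v.1.2 - t * w.1.2, v.2 - t * w.2).

Let dot3_sub (v w u : R * R * R) t : dot3 (sub v w t) u = dot3 v u - t * dot3 w u.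
Proof. by rewrite /dot3 /sub/=; ring. Qed.

Let t1 := time e / time p.
Let t2 := time f / time p.
Let a := sub (space e) (space p) t1.
Let b := sub (space f) (space p) t2.
Let c := sub 0 (space p) (- (time p)^-1).

Let dotc u : dot3 c u = dot3 (space p) u / time p.
Proof. by rewrite /c dot3_sub /dot3/=; ring. Qed.

Let frame : [/\ dot3 a a = 1, dot3 b b = 1, dot3 c c = 1 &
  [/\ dot3 a b = 0, dot3 a c = 0 & dot3 b c = 0]].
Proof.
have pne : time p != 0 by rewrite gt_eqF.
have pp' : dot3 (space p) (space p) = time p ^+ 2.
  by have := pp; rewrite lorentzE => /eqP; rewrite subr_eq0 => /eqP.
have ep' : dot3 (space e) (space p) = time e * time p.
  by have := ep; rewrite lorentzE => /eqP; rewrite subr_eq0 => /eqP.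
have fp' : dot3 (space f) (space p) = time f * time p.
  by have := fp; rewrite lorentzE => /eqP; rewrite subr_eq0 => /eqP.
have ef' : dot3 (space e) (space f) = time e * time f.
  by have := ef; rewrite lorentzE => /eqP; rewrite subr_eq0 => /eqP.
have ee' : dot3 (space e) (space e) = 1 + time e ^+ 2.
  by have := ee; rewrite lorentzE => /eqP; rewrite subr_eq => /eqP.
have ff' : dot3 (space f) (space f) = 1 + time f ^+ 2.
  by have := ff; rewrite lorentzE => /eqP; rewrite subr_eq => /eqP.
have sub2 u v t s : dot3 (sub u (space p) t) (sub v (space p) s) =
    dot3 u v - s * dot3 u (space p) - t * dot3 v (space p) +
    t * s * dot3 (space p) (space p).
  by rewrite /dot3 /sub/=; ring.
have dl (u : R * R * R) : dot3 0 u = 0 by rewrite /dot3/=; ring.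
have dr (u : R * R * R) : dot3 u 0 = 0 by rewrite /dot3/=; ring.
rewrite /a /b /c !sub2 dl !dr !dl ee' ff' ef' ep' fp' pp' /t1 /t2.
by split; [| | | split]; field.
Qed.

Let w_chart u : - lorentz (hyp3_chart u) p = time p * (Num.sqrt (1 + dot3 u u) - dot3 c u).
Proof.
rewrite lorentzE time_hyp3_chart space_hyp3_chart dotc (dot3C u).
by field; rewrite gt_eqF.
Qed.

Let X_chart u : lorentz (hyp3_chart u) e = dot3 a u - t1 * - lorentz (hyp3_chart u) p.
Proof.
rewrite !lorentzE time_hyp3_chart space_hyp3_chart dot3_sub (dot3C u) (dot3C u (space p)) /t1.
by field; rewrite gt_eqF.
Qed.

Let Y_chart u : lorentz (hyp3_chart u) f = dot3 b u - t2 * - lorentz (hyp3_chart u) p.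
Proof.
rewrite !lorentzE time_hyp3_chart space_hyp3_chart dot3_sub (dot3C u) (dot3C u (space p)) /t2.
by field; rewrite gt_eqF.
Qed.

Let w_gt0 (u : R * R * R) : 0 < time p * (Num.sqrt (1 + dot3 u u) - u.2).
Proof.
rewrite mulr_gt0// subr_gt0 (le_lt_trans (ler_norm _))//.
rewrite -sqrtr_sqr ltr_sqrt.
  by rewrite /dot3; nra.
by rewrite /dot3; nra.
Qed.

(** The hyperbolic volume in the upper half space model with p at infinity.
Subtracting multiples of space p from space e and space f makes (a, b, c) an
orthonormal frame, in which - <x, p> = time p * (sqrt (1 + |v|^2) - v3); the
horizontal coordinates become v1 / w and v2 / w up to a translation.  The
substitution in v3 gives dv1 dv2 dw / w, and rescaling v1, v2 by w gives the
factor w^2. *)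
Lemma hyp3_vol_horospherical (E : set (R * R * R)) : measurable E ->
  hyp3_vol [set x | E (horo_coord x)] = horo_volume E.
Proof.
move=> mE.
have [aa bb cc [ab ac bc]] := frame.
have mI : measurable_fun setT (\1_E : R * R * R -> R) by exact: measurable_indic.
pose w (v : R * R * R) := time p * (Num.sqrt (1 + dot3 v v) - v.2).
pose Phi (v : R * R * R) : \bar R :=
  (\1_E ((v.1.1 * (w v)^-1 - t1, v.1.2 * (w v)^-1 - t2), w v) *
   (Num.sqrt (1 + dot3 v v))^-1)%:E.
have mw : measurable_fun setT w by rewrite /w /dot3; meas.
have mPhi : measurable_fun setT Phi.
  apply/measurable_EFinP; apply: measurable_funM; last by rewrite /dot3; meas.
  by apply: (measurableT_comp mI); meas.
have Phi0 v : (0 <= Phi v)%E by rewrite lee_fin mulr_ge0// invr_ge0 sqrtr_ge0.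
rewrite hyp3_volE [LHS]integral_mkcond.
transitivity (\int[leb3]_v Phi (dot3 a v, dot3 b v, dot3 c v))%E.
  apply: eq_integral => u _.
  have N : dot3 (dot3 a u, dot3 b u, dot3 c u) (dot3 a u, dot3 b u, dot3 c u) = dot3 u u.
    by rewrite -[RHS](dot3_frame aa bb cc ab ac bc) [LHS]/dot3/= !expr2.
  have W : w (dot3 a u, dot3 b u, dot3 c u) = - lorentz (hyp3_chart u) p.
    by rewrite w_chart /w N.
  rewrite /Phi N W/= /patch.
  have -> : hyp3_time u = Num.sqrt (1 + dot3 u u) by rewrite -time_hyp3_chart /time mxE.
  have Wne : - lorentz (hyp3_chart u) p != 0 by rewrite -W gt_eqF// w_gt0.
  have -> : dot3 a u / - lorentz (hyp3_chart u) p - t1 =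
      lorentz (hyp3_chart u) e / - lorentz (hyp3_chart u) p.
    by rewrite X_chart [in RHS]mulrBl mulfK.
  have -> : dot3 b u / - lorentz (hyp3_chart u) p - t2 =
      lorentz (hyp3_chart u) f / - lorentz (hyp3_chart u) p.
    by rewrite Y_chart [in RHS]mulrBl mulfK.
  rewrite indicE (_ : (u \in _) = (horo_coord (hyp3_chart u) \in E)).
    by rewrite /horo_coord; case: ifP => _; rewrite ?mul1r ?mul0r.
  by apply/idP/idP; rewrite !inE.
rewrite (leb3_orthogonal aa bb cc ab ac bc mPhi Phi0).
(* K is the integrand after the substitution of w for the last coordinate *)
pose K (v : R * R * R) : \bar R :=
  (if 0 < v.2 then \1_E ((v.2^-1 * v.1.1 + - t1, v.2^-1 * v.1.2 + - t2), v.2) * v.2^-1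
    else 0)%:E.
have mK : measurable_fun setT K.
  apply/measurable_EFinP; apply: measurable_fun_ifT => //;
    first by apply: measurable_fun_ltr => //.
  apply: measurable_funM; last by meas.
  by apply: (measurableT_comp mI); meas.
have K0 v : (0 <= K v)%E.
  by rewrite lee_fin; case: ifPn => // v0; rewrite mulr_ge0// invr_ge0 ltW.
transitivity (\int[leb3]_v K v)%E.
  rewrite (leb3E mPhi Phi0) (leb3E mK K0); apply: eq_integral => -[x y] _.
  have c2_gt0 : 0 < 1 + x ^+ 2 + y ^+ 2 by nra.
  pose C := [set t : R | E ((t^-1 * x + - t1, t^-1 * y + - t2), t)].
  have mC : measurable C.
    have mE' : measurable_fun setT (fun t : R =>
      ((t^-1 * x + - t1, t^-1 * y + - t2), t)) by meas.
    by have := mE' measurableT _ mE; rewrite setTI.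
  transitivity (\int[mu]_v ((\1_C (time p * (Num.sqrt (1 + x ^+ 2 + y ^+ 2 + v ^+ 2) - v)) *
      (Num.sqrt (1 + x ^+ 2 + y ^+ 2 + v ^+ 2))^-1)%:E))%E.
    apply: eq_integral => v _; rewrite /Phi /w.
    have -> : 1 + dot3 (x, y, v) (x, y, v) = 1 + x ^+ 2 + y ^+ 2 + v ^+ 2.
      by rewrite /dot3/=; ring.
    congr (_%:E); congr (_ * _); rewrite !indicE; congr (_%:R).
    by congr nat_of_bool; apply/idP/idP; rewrite !inE /C/= ![_^-1 * _]mulrC.
  rewrite integral_inv_sqrt// integral_mkcond; apply: eq_integral => v _.
  rewrite /patch /K/= indicE.
  have -> : ((v^-1 * x - t1, v^-1 * y - t2, v) \in E) = (v \in C) by apply/idP/idP;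
    rewrite !inE.
  by case: ifPn; case: ifPn => //=; rewrite ?mul1r ?mul0r.
rewrite /horo_volume (leb3E_sym mK K0).
rewrite (leb3E_sym (measurable_horo_density mE) (horo_density_ge0 E));
  apply: eq_integral => t _.
rewrite /K /horo_density/=; have [t0|t0] := ltP 0 t => //.
pose G (v : R * R) : \bar R := (\1_E (v, t) * t^-1)%:E.
have mG : measurable_fun setT G.
  apply/measurable_EFinP; apply: measurable_funM => //.
  by apply: (measurableT_comp mI); meas.
have G0 v : (0 <= G v)%E by rewrite lee_fin mulr_ge0// invr_ge0 ltW.
have tV0 : 0 < t^-1 by rewrite invr_gt0.
rewrite [LHS](leb2_affine (- t1) (- t2) tV0 tV0 mG G0) -ge0_integralZl//; last first.
  by rewrite lee_fin invr_ge0 mulr_ge0// ltW.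
apply: eq_integral => v _; rewrite /G -EFinM; congr EFin.
by field; rewrite gt_eqF.
Qed.

End horospherical_volume.

(** * Volumes of regions below a graph *)

Section cusp_volume.
Context {R : realType}.
Local Notation mu := (@lebesgue_measure R).

Lemma integral_exprn (r : R) (n : nat) : 0 < r ->
  (\int[mu]_(x in `[0%R, r]) (x ^+ n)%:E = (r ^+ n.+1 / n.+1%:R)%:E)%E.
Proof.
move=> r0.
pose F : R -> R := fun x => x ^+ n.+1 / n.+1%:R.
have dF (x : R) : is_derive x 1 F (x ^+ n).
  rewrite (_ : F = n.+1%:R^-1 *: (@id R ^+ n.+1)); last first.
    by apply/funext => y; rewrite /F !fctE /GRing.scale/= mulrC.
  apply: is_derive_eq; rewrite /GRing.scale/=.
  by field; rewrite nat1r pnatr_eq0.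
have cF (x : R) : {for x, continuous F}.
  by apply: differentiable_continuous; apply/derivable1_diffP; have [] := dF x.
rewrite (@continuous_FTC2 _ (fun x => x ^+ n) F)//.
- by rewrite /F expr0n/= mul0r sube0.
- by apply: continuous_subspaceT => x; exact: exprn_continuous.
- split; [by move=> x _; have [] := dF x|..].
  + by apply: cvg_at_right_filter; exact: cF.
  + by apply: cvg_at_left_filter; exact: cF.
- by move=> x _; rewrite derive1E; have [] := dF x.
Qed.

(** The region above a graph in the upper half space: with w = 1 / z the
condition reads h (x, y) <= z^2. *)
Definition cusp (D : set (R * R)) (h : R * R -> R) : set (R * R * R) :=
  [set v | D v.1 /\ v.2 ^+ 2 * h v.1 <= 1].

Section cusp_slices.
Variables (D : set (R * R)) (h : R * R -> R).
Hypotheses (mD : measurable D) (mh : measurable_fun setT h).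

Lemma measurable_cusp : measurable (cusp D h).
Proof.
apply: (@measurableI _ _ (fst @^-1` D)).
  by rewrite -[X in measurable X]setTI; exact: measurable_fst.
apply: measurable_ler_set; last by meas.
apply: measurable_funM; first by meas.
exact: (measurableT_comp mh).
Qed.

(** The integral of w from 0 to h^(-1/2) is 1 / (2 h). *)
Lemma horo_volume_cusp : (forall v, D v -> 0 < h v) ->
  (horo_volume (cusp D h) = \int[leb2]_(v in D) ((2 * h v)^-1)%:E)%E.
Proof.
move=> h_gt0.
rewrite /horo_volume leb3E; last 2 first.
- exact: measurable_horo_density measurable_cusp.
- exact: horo_density_ge0.
rewrite [RHS]integral_mkcond; apply: eq_integral => v _.
rewrite /patch; case: ifPn => [|/negP] /[!inE] Dv; last first.
  apply: integral0_eq => t _; rewrite /horo_density indicE memNset/=; last by move=> -[].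
  by rewrite mul0r if_same.
have hv := h_gt0 _ Dv; pose r := (Num.sqrt (h v))^-1.
have r0 : 0 < r by rewrite invr_gt0 sqrtr_gt0.
have r2 : r ^+ 2 = (h v)^-1 by rewrite exprVn sqr_sqrtr// ltW.
transitivity (\int[mu]_(x in `[0%R, r]) (x ^+ 1)%:E)%E; last first.
  rewrite integral_exprn//; congr EFin; rewrite r2 invfM mulrC//.
rewrite [RHS]integral_mkcond; apply: eq_integral => t _.
rewrite /horo_density/= /patch indicE expr1.
have [t0|t0] := ltP 0 t; last first.
  case: ifPn => // /[!inE]/=; rewrite in_itv/= => /andP[t0' _].
  by congr EFin; apply/le_anti; rewrite t0 t0'.
have -> : ((v, t) \in cusp D h) = (t \in `[0, r]%classic).
  have H : (t ^+ 2 * h v <= 1) = (t <= r).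
    by rewrite -ler_pdivlMr// div1r -r2 ler_pXn2r// nnegrE ltW.
  apply/idP/idP; rewrite !inE/= in_itv/= (ltW t0)/= /cusp/= H; first by case.
  by split.
by case: ifP => _; rewrite ?mul1r ?mul0r.
Qed.

End cusp_slices.

Definition box (r s : R) : set (R * R) := `[0, r]%classic `*` `[0, s]%classic.

Lemma measurable_box r s : measurable (box r s).
Proof. exact: measurableX. Qed.

Definition moment (r : R) (n : nat) : R := r ^+ n.+1 / n.+1%:R.

Lemma moment_ge0 r n : 0 < r -> 0 <= moment r n.
Proof. by move=> r0; rewrite divr_ge0// exprn_ge0 ?ltW. Qed.

Lemma integral_box_monomial (r s : R) (i j : nat) : 0 < r -> 0 < s ->
  (\int[leb2]_(v in box r s) (v.1 ^+ i * v.2 ^+ j)%:E = (moment r i * moment s j)%:E)%E.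
Proof.
move=> r0 s0.
pose F (v : R * R) : \bar R := (\1_(`[0, r]%classic : set R) v.1 * v.1 ^+ i *
  (\1_(`[0, s]%classic : set R) v.2 * v.2 ^+ j))%:E.
have ind0 (t x : R) k : 0 <= \1_(`[0, t]%classic : set R) x * x ^+ k.
  rewrite indicE; case: (boolP (x \in _)) => [/[!inE]/=|_]; last by rewrite mul0r.
  by rewrite in_itv/= => /andP[x0 _]; rewrite mul1r exprn_ge0.
have mind (t : R) k : measurable_fun setT
  (fun x : R => \1_(`[0, t]%classic : set R) x * x ^+ k).
  by apply: measurable_funM => //; exact: measurable_indic.
have iind (t : R) k : 0 < t ->
    (\int[mu]_x (\1_(`[0%R, t]%classic : set R) x * x ^+ k)%:E = (moment t k)%:E)%E.
  move=> t0; rewrite /moment -integral_exprn// [RHS]integral_mkcond.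
  by apply: eq_integral => x _; rewrite /patch indicE; case: ifP => _; rewrite ?mul1r ?mul0r.
have mF : measurable_fun setT F.
  apply/measurable_EFinP; apply: measurable_funM.
    exact: (measurableT_comp (mind r i) measurable_fst).
  exact: (measurableT_comp (mind s j) measurable_snd).
have F0 v : (0 <= F v)%E by rewrite lee_fin mulr_ge0.
rewrite [LHS]integral_mkcond (_ : _ \_ _ = F); last first.
  apply/funext => v; rewrite /patch /F !indicE.
  have -> : (v \in box r s) = (v.1 \in (`[0, r]%classic : set R)) &&
    (v.2 \in (`[0, s]%classic : set R)).
    by apply/idP/andP; rewrite !inE.
  by do 2 case: (_ \in _); rewrite /= ?mul1r ?mul0r ?mulr0.
rewrite (leb2E mF F0) /F/=.
under eq_integral => x _.
  under eq_integral do rewrite EFinM.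
  rewrite ge0_integralZl//; last 3 first.
  - by apply/measurable_EFinP; exact: mind.
  - by move=> y _; rewrite lee_fin.
  - by rewrite lee_fin.
  rewrite iind//.
  over.
rewrite ge0_integralZr//.
- by rewrite iind// -EFinM.
- by apply/measurable_EFinP; exact: mind.
- by move=> x _; rewrite lee_fin.
- by rewrite lee_fin moment_ge0.
Qed.

Lemma horo_volume_box (r s : R) : 0 < r -> 0 < s ->
  horo_volume (cusp (box r s) (fun=> 1)) = (r * s / 2)%:E.
Proof.
move=> r0 s0; rewrite horo_volume_cusp//; last exact: measurable_box.
transitivity (\int[leb2]_(v in box r s) ((2^-1)%:E * (v.1 ^+ 0 * v.2 ^+ 0)%:E))%E.
  by apply: eq_integral => v _; rewrite !expr0 !mulr1 mule1.
rewrite ge0_integralZl ?lee_fin//; last 3 first.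
- exact: measurable_box.
- by apply/measurable_EFinP; apply: measurable_funTS; meas.
- by move=> v _; rewrite !expr0 mulr1 lee_fin.
by rewrite integral_box_monomial// -EFinM /moment !expr1 !divr1; congr EFin; rewrite mulrC.
Qed.

(** The region above the unit hemisphere, over a rectangle with a corner at its
centre. *)
Definition hemisphere_cusp (r s : R) : set (R * R * R) :=
  cusp (box r s) (fun v => 1 - v.1 ^+ 2 - v.2 ^+ 2).

Lemma measurable_hemisphere_cusp r s : measurable (hemisphere_cusp r s).
Proof. by apply: measurable_cusp; [exact: measurable_box|meas]. Qed.

(** The diagonal map from the square to the rectangle has factors 2 r and 2 s,
both at least 1.  It moves points away from the origin, where the hemisphere is
lower, so the region over the square is mapped into the other one. *)
Lemma horo_volume_hemisphere_scale (r s : R) : 2^-1 <= r -> 2^-1 <= s ->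
  (horo_volume (hemisphere_cusp 2^-1 2^-1) <=
   (4 * r * s)^-1%:E * horo_volume (hemisphere_cusp r s))%E.
Proof.
move=> hr hs.
have r0 : 0 < 2 * r by lra.
have s0 : 0 < 2 * s by lra.
have m1 := measurable_horo_density (measurable_hemisphere_cusp 2^-1 2^-1).
have m2 := measurable_horo_density (measurable_hemisphere_cusp r s).
have := @leb3_affine R (2 * r) (2 * s) 1 0 0 0 _ r0 s0 ltr01 m2 (horo_density_ge0 _).
rewrite (_ : 2 * r * (2 * s) * 1 = 4 * r * s); last by ring.
move=> <-; apply: ge0_le_integral => //.
- by move=> *; exact: horo_density_ge0.
- apply: (measurableT_comp m2); meas.
- move=> [[x y] t] _; rewrite /horo_density/= !addr0 mul1r lee_fin.
  have [t0|//] := ltP 0 t.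
  rewrite ler_pM2r// !indicE ler_nat.
  case: (boolP ((x, y, t) \in _)) => // /[!inE] H.
  rewrite mem_set//; move: H => -[[/=]]; rewrite !in_itv/= => /andP[x0 x1] /andP[y0 y1] h.
  split; first by split; rewrite /= in_itv/=; apply/andP; split; nra.
  apply: le_trans h; rewrite /= ler_pM2l ?exprn_gt0//.
  have : x <= 2 * r * x by rewrite ler_peMl//; lra.
  have : y <= 2 * s * y by rewrite ler_peMl//; lra.
  rewrite -2!addrA lerD2l -!opprD lerN2 => *; apply: lerD; rewrite ler_pXn2r// nnegrE; nra.
Qed.

Definition triangle (a b c : R) : set (R * R) :=
  [set v | [/\ 0 <= v.1, 0 <= v.2 & a * v.1 + b * v.2 <= c]].

Lemma measurable_triangle a b c : measurable (triangle a b c).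
Proof.
rewrite (_ : triangle a b c = [set v | 0 <= v.1] `&` [set v | 0 <= v.2] `&`
  [set v | a * v.1 + b * v.2 <= c]); last first.
  by apply/seteqP; split => v /=; [case|case; case].
by apply: measurableI; [apply: measurableI|]; apply: measurable_ler_set; meas.
Qed.

(** Half the area of the triangle, whose legs are c / a and c / b. *)
Lemma horo_volume_triangle (a b c : R) : 0 < a -> 0 < b -> 0 < c ->
  horo_volume (cusp (triangle a b c) (fun=> 1)) = (c ^+ 2 / (4 * a * b))%:E.
Proof.
move=> a0 b0 c0; have mT := measurable_triangle a b c.
rewrite horo_volume_cusp//.
pose G (v : R * R) : \bar R := (\1_(triangle a b c) v * 2^-1)%:E.
have mG : measurable_fun setT G.
  by apply/measurable_EFinP; apply: measurable_funM => //; exact: measurable_indic.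
have G0 v : (0 <= G v)%E by rewrite lee_fin mulr_ge0.
rewrite [LHS]integral_mkcond (_ : _ \_ _ = G); last first.
  by apply/funext => v; rewrite /patch /G indicE mulr1; case: ifP => _; rewrite ?mul1r ?mul0r.
rewrite (leb2E mG G0).
pose f (x : R) := (c - a * x) / (2 * b).
transitivity (\int[mu]_(x in `[0%R, (c / a)%R]) (f x)%:E)%E.
  rewrite [RHS]integral_mkcond; apply: eq_integral => x _; rewrite /patch.
  case: ifPn => [|/negP] /[!inE]/=; rewrite in_itv/= => hx; last first.
    apply: integral0_eq => y _; rewrite /G indicE memNset ?mul0r//= => -[/= x0 y0 h].
    by apply: hx; rewrite x0/= ler_pdivlMr//; nra.
  have {hx}[x0 xc] := andP hx.
  have := xc; rewrite ler_pdivlMr// => axc.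
  transitivity (\int[mu]_(y in `[0%R, ((c - a * x) / b)%R]) (cst (2^-1)%:E y))%E; last first.
    rewrite integral_cst// [X in (_ * X)%E](@lebesgue_measure_itv R
      `[0, (c - a * x) / b]%R)/= lte_fin.
    have [h|h] := ltP; first by rewrite -EFinB -EFinM /f; congr EFin; field; rewrite gt_eqF.
    rewrite mule0 /f; suff -> : c - a * x = 0 by rewrite mul0r.
    by move: h; rewrite pmulr_lle0 ?invr_gt0// => h; apply/le_anti; rewrite h/= subr_ge0 mulrC.
  rewrite [RHS]integral_mkcond; apply: eq_integral => y _; rewrite /patch /G indicE.
  have -> : ((x, y) \in triangle a b c) = (y \in `[0, (c - a * x) / b]%classic).
    apply/idP/idP; rewrite !inE/= in_itv/= /triangle/= ler_pdivlMr// lerBrDl [y * b]mulrC.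
      by move=> -[_ -> ->].
    by move=> /andP[-> ->].
  by case: ifP => _; rewrite ?mul1r ?mul0r.
pose F (x : R) : R := - (c - a * x) ^+ 2 / (4 * a * b).
have dF (x : R) : is_derive x 1 F (f x).
  rewrite (_ : F = (- (4 * a * b)^-1) *: ((cst c - a *: @id R) ^+ 2)); last first.
    by apply/funext => y; rewrite /F !fctE /GRing.scale/= mulrC mulrN mulNr.
  apply: is_derive_eq; rewrite /f !fctE /GRing.scale/=.
  by field; rewrite !gt_eqF.
have cF (x : R) : {for x, continuous F}.
  by apply: differentiable_continuous; apply/derivable1_diffP; have [] := dF x.
rewrite (@continuous_FTC2 _ f F) ?divr_gt0//.
- by rewrite -EFinB /F; congr EFin; field; rewrite !gt_eqF.
- apply: continuous_subspaceT => x; apply: cvgM; last exact: cvg_cst.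
  apply: cvgB; first exact: cvg_cst.
  by apply: cvgM; [exact: cvg_cst|exact: cvg_id].
- split; [by move=> x _; have [] := dF x|..].
  + by apply: cvg_at_right_filter; exact: cF.
  + by apply: cvg_at_left_filter; exact: cF.
- by move=> x _; rewrite derive1E; have [] := dF x.
Qed.

(** The integral of (x^2 + y^2)^k over the square [0, 1/2]^2, expanded by the
binomial formula. *)
Definition radial_moment (k : nat) : R :=
  \sum_(i < k.+1) (moment 2^-1 (2 * (k - i)) * moment 2^-1 (2 * i)) *+ 'C(k, i).

Lemma integral_radial_moment (k : nat) :
  (\int[leb2]_(v in box 2^-1 2^-1) ((v.1 ^+ 2 + v.2 ^+ 2) ^+ k)%:E =
   (radial_moment k)%:E)%E.
Proof.
transitivity (\int[leb2]_(v in box 2^-1 2^-1)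
  \sum_(i <- index_enum 'I_k.+1) ('C(k, i)%:R%:E *
    (v.1 ^+ (2 * (k - i)) * v.2 ^+ (2 * i))%:E))%E.
  apply: eq_integral => v _; rewrite exprDn sumEFin; congr EFin.
  by apply: eq_bigr => i _; rewrite -!exprM mulr_natl.
rewrite ge0_integral_sum; last 3 first.
- exact: measurable_box.
- move=> i; apply/measurable_EFinP; apply: measurable_funTS; meas.
- move=> i v; rewrite /box/= !in_itv/= => -[/andP[x0 _] /andP[y0 _]].
  by rewrite lee_fin mulr_ge0// mulr_ge0// exprn_ge0.
rewrite /radial_moment -sumEFin; apply: eq_bigr => i _.
rewrite ge0_integralZl ?lee_fin//; last 3 first.
- exact: measurable_box.
- by apply/measurable_EFinP; apply: measurable_funTS; meas.
- move=> v; rewrite /box/= !in_itv/= => -[/andP[x0 _] /andP[y0 _]].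
  by rewrite lee_fin mulr_ge0// exprn_ge0.
by rewrite integral_box_monomial// -EFinM mulr_natl.
Qed.

Lemma geometric_sandwich (s : R) (n : nat) : 0 <= s -> s <= 2^-1 ->
  \sum_(k < n) s ^+ k <= (1 - s)^-1 <= \sum_(k < n) s ^+ k + 2 * s ^+ n.
Proof.
move=> s0 s1; have h : 0 < 1 - s by lra.
have E : (1 - s) * \sum_(k < n) s ^+ k = 1 - s ^+ n.
  by have := subrX1 s n => H; rewrite -(opprB s 1) mulNr -H opprB.
have sn : 0 <= s ^+ n by rewrite exprn_ge0.
have -> : (1 - s)^-1 = \sum_(k < n) s ^+ k + s ^+ n / (1 - s).
  apply: (@mulfI _ (1 - s)); first by rewrite gt_eqF.
  by rewrite divff ?gt_eqF// mulrDr E mulrCA divff ?gt_eqF// mulr1 subrK.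
rewrite lerDl divr_ge0 ?(ltW h)//= lerD2l mulrC ler_wpM2r// -[leRHS]invrK lef_pV2
  ?posrE// ?invr_gt0//; lra.
Qed.

Lemma integral_radial_sum (n : nat) (c : R) : 0 <= c ->
  (\int[leb2]_(v in box 2^-1 2^-1) (2^-1 * (\sum_(k < n) (v.1 ^+ 2 + v.2 ^+ 2) ^+ k) + c
    * (v.1 ^+ 2 + v.2 ^+ 2) ^+ n)%:E =
   (2^-1 * (\sum_(k < n) radial_moment k) + c * radial_moment n)%:E)%E.
Proof.
move=> c0.
have mX k : measurable_fun (box 2^-1 2^-1) (fun v : R * R => (v.1 ^+ 2 + v.2 ^+ 2) ^+ k).
  by apply: measurable_funTS; meas.
have X0 (v : R * R) k : 0 <= (v.1 ^+ 2 + v.2 ^+ 2) ^+ k.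
  by rewrite exprn_ge0// addr_ge0// sqr_ge0.
have mb := measurable_box 2^-1 2^-1.
under eq_integral do rewrite EFinD !EFinM -sumEFin.
have mS : measurable_fun (box 2^-1 2^-1)
  (fun v : R * R => \sum_(k < n) ((v.1 ^+ 2 + v.2 ^+ 2) ^+ k)%:E)%E.
  by apply: emeasurable_sum => k; apply/measurable_EFinP.
have S0 (v : R * R) : (0 <= \sum_(k < n) ((v.1 ^+ 2 + v.2 ^+ 2) ^+ k)%:E)%E.
  by apply: sume_ge0 => k _; rewrite lee_fin.
rewrite ge0_integralD//; last 4 first.
- by move=> v _; rewrite mule_ge0.
- exact: measurable_funeM.
- by move=> v _; rewrite mule_ge0 ?lee_fin.
- by apply: measurable_funeM; apply/measurable_EFinP; exact: mX.
rewrite ge0_integralZl//.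
rewrite ge0_integral_sum//; last 2 first.
- by move=> k; apply/measurable_EFinP; exact: mX.
- by move=> k v _; rewrite lee_fin.
rewrite ge0_integralZl//; last 2 first.
- by apply/measurable_EFinP; exact: mX.
- by move=> v _; rewrite lee_fin.
rewrite integral_radial_moment; under eq_bigr do rewrite integral_radial_moment.
by rewrite sumEFin.
Qed.

(** The geometric series for 1 / (1 - s) is integrated term by term; the factor 2
in the bound of its remainder cancels the 1/2 of horo_volume_cusp. *)
Lemma horo_volume_hemisphere_bounds (n : nat) (S : R) :
  S = 2^-1 * \sum_(k < n) radial_moment k ->
  (S%:E <= horo_volume (hemisphere_cusp 2^-1 2^-1) <= (S + radial_moment n)%:E)%E.
Proof.
move=> ->.
have mb := measurable_box 2^-1 2^-1.
have bounds (v : R * R) : box 2^-1 2^-1 v ->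
   let s := v.1 ^+ 2 + v.2 ^+ 2 in [/\ 0 <= s, s <= 2^-1 & 1 - v.1 ^+ 2 - v.2 ^+ 2 = 1 - s].
  rewrite /box/= !in_itv/= => -[/andP[x0 x1] /andP[y0 y1]]; split; [|nra|ring].
  by rewrite addr_ge0// sqr_ge0.
have mX k : measurable_fun (box 2^-1 2^-1) (fun v : R * R => (v.1 ^+ 2 + v.2 ^+ 2) ^+ k).
  by apply: measurable_funTS; meas.
have mS : measurable_fun (box 2^-1 2^-1)
  (fun v : R * R => \sum_(k < n) (v.1 ^+ 2 + v.2 ^+ 2) ^+ k).
  by apply: measurable_sum => k.
rewrite /hemisphere_cusp horo_volume_cusp//; last 2 first.
- by meas.
- by move=> v /bounds[s0 s1 ->]; lra.
apply/andP; split.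
- have := @integral_radial_sum n 0 (lexx 0); rewrite mul0r addr0 => <-.
  apply: ge0_le_integral => //.
  + move=> v /bounds[s0 s1 _]; rewrite lee_fin mul0r addr0 mulr_ge0// sumr_ge0// => k _.
    by rewrite exprn_ge0.
  + apply/measurable_EFinP; apply: measurable_funD; first by apply: measurable_funM.
    by apply: measurable_funM; [exact: measurable_cst|exact: mX].
  + by apply/measurable_EFinP; apply: measurable_funTS; meas.
  + move=> v /bounds[s0 s1 ->]; rewrite lee_fin mul0r addr0 invfM ler_pM2l ?invr_gt0//.
    by have /andP[] := geometric_sandwich n s0 s1.
- have := @integral_radial_sum n 1 ler01; rewrite mul1r => <-.
  apply: ge0_le_integral => //.
  + by move=> v /bounds[s0 s1 ->]; rewrite lee_fin invr_ge0; lra.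
  + by apply/measurable_EFinP; apply: measurable_funTS; meas.
  + apply/measurable_EFinP; apply: measurable_funD; first by apply: measurable_funM.
    by apply: measurable_funM; [exact: measurable_cst|exact: mX].
  + move=> v /bounds[s0 s1 ->]; rewrite lee_fin invfM mul1r.
    have /andP[_ h] := geometric_sandwich n s0 s1.
    lra.
Qed.

End cusp_volume.

(** * A recurrence for the radial moments *)

Section radial_moments.
Context {R : realType}.
Local Notation radial_moment := (@radial_moment R).

(** The integral of (1 + y^2)^k over [0, 1]. *)
Definition edge_moment (k : nat) : R :=
  \sum_(i < k.+1) 'C(k, i)%:R / (2 * i).+1%:R.

(** Writing 2 k + 3 as (2 i + 1) + 2 (k + 1 - i) in the i-th term splits the sum
into 2^(k + 1) and a multiple of the previous one, because
(k + 1 - i) 'C(k + 1, i) = (k + 1) 'C(k, i). *)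
Lemma edge_momentS (k : nat) :
  (2 * k%:R + 3) * edge_moment k.+1 = 2 * (k%:R + 1) * edge_moment k + 2 ^+ k.+1.
Proof.
have -> : (2 : R) ^+ k.+1 = \sum_(i < k.+2) 'C(k.+1, i)%:R.
  rewrite -[2]/(1 + 1) exprDn; apply: eq_bigr => i _.
  by rewrite !expr1n mulr1.
have -> : 2 * (k%:R + 1) * edge_moment k =
    \sum_(i < k.+2) 2 * (k.+1 - i)%:R * 'C(k.+1, i)%:R / (2 * i).+1%:R.
  rewrite big_ord_recr/= subnn mulr0 !mul0r addr0 mulr_sumr; apply: eq_bigr => i _.
  rewrite -[2 * _ * _ in RHS]mulrA -natrM -mul_bin_down/= natrM -natr1.
  by ring.
rewrite mulr_sumr -big_split/=; apply: eq_bigr => i _.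
have : (i <= k.+1)%N by rewrite -ltnS.
move=> ik; rewrite natrB// -[k.+1%:R]natr1 -[(2 * i).+1%:R]natr1 natrM.
by field; rewrite -natrM natr1 pnatr_eq0.
Qed.

(** The integral of a homogeneous function over a square with a corner at the
origin reduces to one over the two opposite edges, which agree by symmetry.  On
the coefficients, 1 / ((2 i + 1) (2 j + 1)) with i + j = k is split into partial
fractions, and 'C(k, i) = 'C(k, j). *)
Lemma radial_momentE (k : nat) :
  (k%:R + 1) * 4 ^+ k.+1 * radial_moment k = edge_moment k.
Proof.
pose G i : R := 'C(k, i)%:R / (2 * i).+1%:R.
have rev : \sum_(i < k.+1) G (k - i)%N = edge_moment k.
  rewrite /edge_moment (reindex_inj rev_ord_inj)/=; apply: eq_bigr => i _.
  by rewrite subSS subKn// -ltnS.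
have -> : edge_moment k = 2^-1 * \sum_(i < k.+1) (G i + G (k - i)%N).
  by rewrite big_split/= rev -[X in X + _]/(edge_moment k); field.
rewrite /radial_moment !mulr_sumr; apply: eq_bigr => i _.
have ik : (i <= k)%N by rewrite -ltnS.
rewrite /moment /G bin_sub// -mulr_natr.
have -> : (4 : R) ^+ k.+1 = 2 ^+ (2 * (k - i)).+1 * 2 ^+ (2 * i).+1.
  rewrite -exprD (_ : (4 : R) = 2 ^+ 2); last by ring.
  by rewrite -exprM; congr (_ ^+ _); lia.
have e (n : nat) : (2 : R)^-1 ^+ n = (2 ^+ n)^-1 by rewrite exprVn.
have k2 : k%:R = (k - i)%:R + i%:R :> R by rewrite -natrD subnK.
rewrite !e -[(2 * (k - i)).+1%:R]natr1 -[(2 * i).+1%:R]natr1 !natrM k2.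
by field; rewrite -!natrM !natr1 !pnatr_eq0 !expf_neq0 ?pnatr_eq0.
Qed.

Lemma radial_momentS (k : nat) :
  4 * (2 * k%:R + 3) * (k%:R + 2) * radial_moment k.+1 =
  2 * (k%:R + 1) ^+ 2 * radial_moment k + 2^-1 ^+ k.+1.
Proof.
have := edge_momentS k; rewrite -!radial_momentE -[k.+1%:R]natr1.
have e : (4 : R) ^+ k.+1 * 2^-1 ^+ k.+1 = 2 ^+ k.+1.
  by rewrite -exprMn; congr (_ ^+ _); field.
rewrite -e => h; apply: (@mulfI _ (4 ^+ k.+1)); first by rewrite expf_neq0// pnatr_eq0.
move: h; rewrite [4 ^+ k.+2]exprS; move: (4 ^+ k.+1) (2^-1 ^+ k.+1) => X Y h.
transitivity ((2 * k%:R + 3) * ((k%:R + 1 + 1) * (4 * X) * radial_moment k.+1)); first by ring.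
by rewrite h; ring.
Qed.

Lemma radial_moment0 : radial_moment 0 = 4^-1.
Proof.
have := radial_momentE 0; rewrite /edge_moment big_ord1 bin0 muln0 divr1 => h.
lra.
Qed.

(** The recurrence makes both claims consequences of 23 linear equations with
small coefficients.  Between these bounds the density has the required rounding;
since s <= 1/2, with equality only at a corner of the square, 22 terms of the
series are enough to reach them. *)
Lemma radial_bounds :
  ((3053%:R * 1000%:R + 218%:R) * 1000%:R + 643%:R) / 10%:R ^+ 10 <=
    \sum_(k < 22) radial_moment k /\
  \sum_(k < 22) radial_moment k + 2 * radial_moment 22 <=
    (3053%:R * 1000%:R + 219%:R) / 10%:R ^+ 7.
Proof.
rewrite !big_ord_recr big_ord0 /=.
have := radial_momentS 0; have := radial_momentS 1; have := radial_momentS 2;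
have := radial_momentS 3; have := radial_momentS 4; have := radial_momentS 5;
have := radial_momentS 6; have := radial_momentS 7; have := radial_momentS 8;
have := radial_momentS 9; have := radial_momentS 10; have := radial_momentS 11;
have := radial_momentS 12; have := radial_momentS 13; have := radial_momentS 14;
have := radial_momentS 15; have := radial_momentS 16; have := radial_momentS 17;
have := radial_momentS 18; have := radial_momentS 19; have := radial_momentS 20;
have := radial_momentS 21; have := radial_moment0.
by move=> *; split; lra.
Qed.

End radial_moments.

(** * Lorentz geometry *)

Section lorentz_form.
Context {R : realType}.
Implicit Types x y z p n : 'rV[R]_4.

Lemma lorentzC x y : lorentz x y = lorentz y x.
Proof. by rewrite !lorentzE /dot3; ring. Qed.

Lemma lorentzDl x y z : lorentz (x + y) z = lorentz x z + lorentz y z.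
Proof. by rewrite !lorentzE /dot3 /space /time/= !mxE; ring. Qed.

Lemma lorentzZl c x z : lorentz (c *: x) z = c * lorentz x z.
Proof. by rewrite !lorentzE /dot3 /space /time/= !mxE; ring. Qed.

Lemma lorentzNl x z : lorentz (- x) z = - lorentz x z.
Proof. by rewrite -scaleN1r lorentzZl mulN1r. Qed.

Lemma lorentzDr x y z : lorentz z (x + y) = lorentz z x + lorentz z y.
Proof. by rewrite lorentzC lorentzDl !(lorentzC z). Qed.

Lemma lorentzZr c x z : lorentz z (c *: x) = c * lorentz z x.
Proof. by rewrite lorentzC lorentzZl (lorentzC z). Qed.

Lemma lorentzNr x z : lorentz z (- x) = - lorentz z x.
Proof. by rewrite lorentzC lorentzNl (lorentzC z). Qed.

Definition lorentz_lin := (lorentzDl, lorentzDr, lorentzZl, lorentzZr, lorentzNl, lorentzNr).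

(** The expansion in a basis with dual basis e, f, -q, -p: the matrix of the
products with the dual basis is a right inverse of the matrix of the basis, hence
also a left inverse. *)
Lemma lorentz_frame (e f p q : 'rV[R]_4) :
  lorentz e e = 1 -> lorentz f f = 1 -> lorentz e f = 0 ->
  lorentz e p = 0 -> lorentz f p = 0 -> lorentz e q = 0 -> lorentz f q = 0 ->
  lorentz p p = 0 -> lorentz q q = 0 -> lorentz p q = -1 -> forall z,
  z = lorentz z e *: e + lorentz z f *: f - lorentz z q *: p - lorentz z p *: q.
Proof.
move=> ee ff ef ep fp eq fq pp qq pq z.
pose J : 'M[R]_4 := diag_mx (\row_(j < 4) (if j == ord0 then -1 else 1)).
pose B : 'M[R]_4 := \matrix_(i < 4) nth 0 [:: e; f; p; q] i.
pose D : 'M[R]_4 := \matrix_(i < 4) nth 0 [:: e; f; - q; - p] i.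
have JE m (X : 'M[R]_(m, 4)) i j :
    (X *m (J *m D^T)) i j = lorentz (row i X) (row j D).
  rewrite mulmxA mxE lorentzE /J mul_mx_diag !big_ord_recl big_ord0 /dot3 /space /time.
  by rewrite !mxE/=; ring.
have DB : B *m (J *m D^T) = 1%:M.
  apply/matrixP => i j; rewrite JE !rowK.
  case: i => [[|[|[|[|//]]]] ?]; case: j => [[|[|[|[|//]]]] ?];
   by rewrite /= ?lorentz_lin ?(lorentzC f e) ?(lorentzC p e) ?(lorentzC q e)
     ?(lorentzC p f) ?(lorentzC q f) ?(lorentzC q p)
    ?(ee, ff, ef, ep, fp, eq, fq, pp, qq, pq) ?mxE ?oppr0 ?opprK//=.
have zE : z = z *m (J *m D^T) *m B by rewrite -mulmxA (mulmx1C DB) mulmx1.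
rewrite [LHS]zE; apply/rowP => j; rewrite mxE !big_ord_recl big_ord0 !JE !rowK/= row_id !mxE/=.
by rewrite !lorentz_lin addr0 !addrA !mulNr.
Qed.

Lemma lorentz_frame_norm (e f p q : 'rV[R]_4) :
  lorentz e e = 1 -> lorentz f f = 1 -> lorentz e f = 0 ->
  lorentz e p = 0 -> lorentz f p = 0 -> lorentz e q = 0 -> lorentz f q = 0 ->
  lorentz p p = 0 -> lorentz q q = 0 -> lorentz p q = -1 -> forall z,
  lorentz z z = lorentz z e ^+ 2 + lorentz z f ^+ 2 - 2 * (lorentz z p * lorentz z q).
Proof.
move=> ee ff ef ep fp eq fq pp qq pq z.
rewrite {2}(lorentz_frame ee ff ef ep fp eq fq pp qq pq z) !lorentz_lin.
ring.
Qed.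

Lemma dot3_cauchy (v w : R * R * R) : dot3 v w ^+ 2 <= dot3 v v * dot3 w w.
Proof.
move: v w => [[v1 v2] v3] [[w1 w2] w3]; rewrite /dot3/=.
rewrite -subr_ge0 [X in 0 <= X](_ : _ = (v1 * w2 - v2 * w1) ^+ 2 + (v1 * w3 - v3 * w1)
  ^+ 2 + (v2 * w3 - v3 * w2) ^+ 2); last by ring.
by rewrite !addr_ge0// sqr_ge0.
Qed.

(** The reversed Cauchy-Schwarz inequality: |x| < x^0 and |p| = p^0. *)
Lemma lorentz_hyp3_light_cone x p : hyp3 x -> light_cone p -> lorentz x p < 0.
Proof.
rewrite /hyp3 /light_cone/= -/(time x) -/(time p) !lorentzE => -[xx x0] [pp p0].
have C := dot3_cauchy (space x) (space p).
rewrite subr_lt0 (le_lt_trans (ler_norm _))//.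
rewrite -(ltr_pXn2r (n := 2))// ?nnegrE ?mulr_ge0 ?(ltW x0) ?(ltW p0)// real_normK ?num_real//.
apply: (le_lt_trans C).
have -> : dot3 (space x) (space x) = time x ^+ 2 - 1 by rewrite expr2; lra.
have -> : dot3 (space p) (space p) = time p ^+ 2 by rewrite expr2; lra.
have := exprn_gt0 2 p0; nra.
Qed.

Lemma timelike_time_neq0 x : lorentz x x = -1 -> time x != 0.
Proof.
rewrite lorentzE => h; apply/eqP => x0; move: h; rewrite x0 mul0r subr0 /dot3 => h.
nra.
Qed.

(** The product with a future null vector is negative on the future sheet and
positive on the past sheet. *)
Lemma hyp3_of_lorentz_lt0 x p :
  lorentz x x = -1 -> light_cone p -> lorentz x p < 0 -> hyp3 x.
Proof.
move=> xx pL xp; split => //; rewrite -/(time x) lt_neqAle eq_sym timelike_time_neq0//=.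
rewrite leNgt; apply/negP => x0.
suff : lorentz (- x) p < 0 by rewrite lorentzNl; lra.
apply: lorentz_hyp3_light_cone => //; split; first by rewrite lorentzNl lorentzNr opprK.
by rewrite mxE oppr_gt0.
Qed.

Lemma light_cone_of_lorentz_lt0 x p :
  hyp3 x -> lorentz p p = 0 -> lorentz x p < 0 -> light_cone p.
Proof.
move=> xH pp xp; split => //; rewrite -/(time p) ltNge le_eqVlt; apply/negP => /predU1P[p0|p0].
  have := dot3_cauchy (space x) (space p).
  have pp0 : dot3 (space p) (space p) = 0 by move: pp; rewrite lorentzE p0 mul0r subr0.
  move: xp; rewrite pp0 mulr0 lorentzE p0 mulr0 subr0; nra.
suff : lorentz x (- p) < 0 by rewrite lorentzNr; lra.
apply: lorentz_hyp3_light_cone => //; split; first by rewrite lorentzNl lorentzNr opprK.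
by rewrite mxE oppr_gt0.
Qed.

(** A horoball on one side of a plane has its size bounded by the product c of
its centre with the unit normal.  The witness against -1 < c is the point x of
the horosphere that lies on the geodesic from the centre orthogonal to the plane:
in the span of p and n it is determined by <x, p> = -1 and <x, x> = -1. *)
Lemma horoball_halfspace p n : light_cone p -> lorentz n n = 1 -> lorentz p n < 0 ->
  horoball p `<=` [set x | lorentz x n <= 0] -> lorentz p n <= -1.
Proof.
move=> pL nn pn sub; rewrite leNgt; apply/negP => h.
have pp : lorentz p p = 0 by case: pL.
set c := lorentz p n in pn h.
(* the coefficient of n that makes <x, p> = -1 *)
pose t := - c^-1.
have c0 : c != 0 by rewrite lt_eqF.
have ct : c * t = -1 by rewrite /t mulrN divff.
have t1 : 1 < t by nra.
pose x := ((t ^+ 2 + 1) / 2) *: p + t *: n.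
have xp : lorentz x p = -1.
  by rewrite /x !lorentz_lin pp (lorentzC n) -/c mulr0 add0r mulrC.
have xn : lorentz x n = (t - t^-1) / 2.
  rewrite /x !lorentz_lin nn -/c (_ : c = - t^-1); last by rewrite /t invrN invrK opprK.
  by field; lra.
have xx : lorentz x x = -1.
  rewrite {2}/x lorentzDr !lorentzZr xp xn.
  by field; lra.
have xH : hyp3 x by apply: (hyp3_of_lorentz_lt0 xx pL); rewrite xp; lra.
have := sub x; rewrite /horoball/= xp xn => /(_ (conj xH (lexx _))).
have : t^-1 < 1 by rewrite invf_lt1//; lra.
lra.
Qed.

End lorentz_form.

Section hyp3_volume_facts.
Context {R : realType}.
Local Notation mu := (@lebesgue_measure R).

Lemma hyp3_hyp3_chart (y : R * R * R) : hyp3 (hyp3_chart y).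
Proof.
have h : 0 < 1 + dot3 y y by rewrite /dot3; nra.
split; last by rewrite -/(time _) time_hyp3_chart sqrtr_gt0.
rewrite lorentzE space_hyp3_chart time_hyp3_chart -expr2 sqr_sqrtr ?ltW//; lra.
Qed.

Lemma eq_hyp3_vol (A B : set 'rV[R]_4) :
  (forall x, hyp3 x -> A x <-> B x) -> hyp3_vol A = hyp3_vol B.
Proof.
move=> AB; rewrite !hyp3_volE; congr (integral _ _ _).
by apply/seteqP; split => y /=; apply AB; exact: hyp3_hyp3_chart.
Qed.

Lemma measurable_hyp3_time : measurable_fun setT (@hyp3_time R).
Proof. by rewrite /hyp3_time; meas. Qed.

Lemma le_hyp3_vol (A B : set 'rV[R]_4) :
  measurable (@hyp3_chart R @^-1` A) -> measurable (@hyp3_chart R @^-1` B) ->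
  (forall x, hyp3 x -> A x -> B x) -> (hyp3_vol A <= hyp3_vol B)%E.
Proof.
move=> mA mB AB; rewrite !hyp3_volE; apply: ge0_subset_integral => //.
- apply: measurable_funTS; apply/measurable_EFinP.
  exact: (measurableT_comp (@measurable_invr R) measurable_hyp3_time).
- by move=> y _; rewrite lee_fin invr_ge0 sqrtr_ge0.
- by move=> y; exact/AB/hyp3_hyp3_chart.
Qed.

Lemma measurable_lorentz (n : 'rV[R]_4) :
  measurable_fun setT (fun y : R * R * R => lorentz (hyp3_chart y) n).
Proof.
under eq_fun do rewrite lorentzE space_hyp3_chart time_hyp3_chart.
by rewrite /dot3; meas.
Qed.

Lemma measurable_polyhedron (u : 'I_5 -> 'rV[R]_4) :
  measurable (@hyp3_chart R @^-1` polyhedron u).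
Proof.
rewrite (_ : _ @^-1` _ = \bigcap_(i in [set: 'I_5])
  [set y | lorentz (hyp3_chart y) (u i) <= 0]); last first.
  apply/seteqP; split => y /=; first by move=> [_ h] i _; exact: h.
  by move=> h; split; [exact: hyp3_hyp3_chart|move=> i; exact: h].
apply: fin_bigcap_measurable => // i _.
apply: measurable_ler_set => //; exact: measurable_lorentz.
Qed.

Lemma measurable_horoball (p : 'rV[R]_4) :
  measurable (@hyp3_chart R @^-1` horoball p).
Proof.
rewrite (_ : _ @^-1` _ = [set y | -1 <= lorentz (hyp3_chart y) p]); last first.
  apply/seteqP; split => y /=; first by case.
  by split => //; exact: hyp3_hyp3_chart.
apply: measurable_ler_set => //; exact: measurable_lorentz.
Qed.

Lemma measurable_horo_coord (p e f : 'rV[R]_4) (E : set (R * R * R)) : measurable E ->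
  measurable (@hyp3_chart R @^-1` [set x | E (horo_coord p e f x)]).
Proof.
move=> mE.
have m : measurable_fun setT (fun y : R * R * R => horo_coord p e f (hyp3_chart y)).
  have mp := measurable_lorentz p; have me := measurable_lorentz e; have mf :=
    measurable_lorentz f.
  by rewrite /horo_coord; meas.
by have := m measurableT _ mE; rewrite setTI.
Qed.

Lemma measurable_horoball_polyhedron (p : 'rV[R]_4) (u : 'I_5 -> 'rV[R]_4) :
  measurable (@hyp3_chart R @^-1` (horoball p `&` polyhedron u)).
Proof.
rewrite preimage_setI.
by apply: measurableI; [exact: measurable_horoball|exact: measurable_polyhedron].
Qed.

End hyp3_volume_facts.

(** * The truncated orthoscheme in horospherical coordinates *)

(** On the left, the expansion of the finite ideal vertex in the frame e, f, p, k;
on the right, its expression in the face normals. *)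
Lemma null_combination (R : realType) (e f p k : 'rV[R]_4) (a b w : R) :
  a ^+ 2 + b ^+ 2 = 1 ->
  (a * - w) *: e + (b * - w) *: f - (w / 2) *: p - w *: k =
  - w *: (k - 2^-1 *: p + a *: (a *: p + e) + b *: (b *: p + f)).
Proof.
move=> ab1; apply/rowP => j; rewrite !mxE.
move: (e _ _) (f _ _) (k _ _) (p _ _) => E F K P.
transitivity (- w * (K - 2^-1 * P + (a * E + b * F) + (a ^+ 2 + b ^+ 2) * P)); last by ring.
by rewrite ab1; field.
Qed.

Section truncated_orthoscheme.
Context {R : realType}.
Variables (q r : nat) (u : 'I_5 -> 'rV[R]_4).
Variables a b : R.
Hypotheses (aE : cos (pi / q%:R) = a) (bE : cos (pi / r%:R) = b).
Hypotheses (a_ge : 2^-1 <= a) (b_ge : 2^-1 <= b) (ab_le : a ^+ 2 + b ^+ 2 <= 1).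
Hypothesis ou : orthoscheme q r u.

Let u0 := u (@Ordinal 5 0 isT).
Let u1 := u (@Ordinal 5 1 isT).
Let u2 := u (@Ordinal 5 2 isT).
Let u3 := u (@Ordinal 5 3 isT).
Let u4 := u (@Ordinal 5 4 isT).

Let a_gt0 : 0 < a. Proof. by apply: lt_le_trans a_ge; rewrite invr_gt0. Qed.
Let b_gt0 : 0 < b. Proof. by apply: lt_le_trans b_ge; rewrite invr_gt0. Qed.

Let g i j : lorentz (u i) (u j) = nth 0 (nth [::] (gram_table R q r) i) j.
Proof. by have [h _] := ou; rewrite h mxE. Qed.

Let g00 : lorentz u0 u0 = 1. Proof. exact: g. Qed.
Let g11 : lorentz u1 u1 = 1. Proof. exact: g. Qed.
Let g22 : lorentz u2 u2 = 1. Proof. exact: g. Qed.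
Let g33 : lorentz u3 u3 = 1. Proof. exact: g. Qed.
Let g44 : lorentz u4 u4 = 1. Proof. exact: g. Qed.
Let g01 : lorentz u0 u1 = -1. Proof. exact: g. Qed.
Let g02 : lorentz u0 u2 = 0. Proof. exact: g. Qed.
Let g03 : lorentz u0 u3 = 0. Proof. exact: g. Qed.
Let g04 : lorentz u0 u4 = 0. Proof. exact: g. Qed.
Let g12 : lorentz u1 u2 = - a. Proof. by rewrite g /= aE. Qed.
Let g13 : lorentz u1 u3 = 0. Proof. exact: g. Qed.
Let g14 : lorentz u1 u4 = 0. Proof. exact: g. Qed.
Let g23 : lorentz u2 u3 = - b. Proof. by rewrite g /= bE. Qed.
Let g24 : lorentz u2 u4 = 0. Proof. exact: g. Qed.
Let g34 : lorentz u3 u4 = -1. Proof. exact: g. Qed.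

Let gramE := (g00, g11, g22, g33, g44, g01, g02, g03, g04, g12, g13, g14, g23, g24, g34,
  (lorentzC u1 u0, lorentzC u2 u0, lorentzC u3 u0, lorentzC u4 u0, lorentzC u2 u1,
   lorentzC u3 u1, lorentzC u4 u1, lorentzC u3 u2, lorentzC u4 u2, lorentzC u4 u3)).

(** A null frame adapted to the faces: p spans the ideal vertex of the parallel
faces and is scaled so that its product with u2 is -1, e and f are the inner
normals of u0 and u4, and k is the point at infinity below the origin of the
horizontal coordinates. *)
Let p := a^-1 *: (u0 + u1).
Let e := - u0.
Let f := - u4.
Let k := u2 + 2^-1 *: p.

Let pp : lorentz p p = 0.
Proof. by rewrite /p !lorentz_lin !gramE; ring. Qed.
Let ee : lorentz e e = 1. Proof. by rewrite !lorentz_lin gramE opprK. Qed.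
Let ff : lorentz f f = 1. Proof. by rewrite !lorentz_lin gramE opprK. Qed.
Let ef : lorentz e f = 0. Proof. by rewrite !lorentz_lin gramE !oppr0. Qed.
Let ep : lorentz e p = 0.
Proof. by rewrite !lorentz_lin !gramE; ring. Qed.
Let fp : lorentz f p = 0.
Proof. by rewrite !lorentz_lin !gramE; ring. Qed.
Let pu2 : lorentz p u2 = -1.
Proof. by rewrite !lorentz_lin !gramE add0r mulrN mulVf ?gt_eqF. Qed.
Let ek : lorentz e k = 0.
Proof. by rewrite lorentzDr lorentzZr ep !lorentz_lin !gramE; ring. Qed.
Let fk : lorentz f k = 0.
Proof. by rewrite lorentzDr lorentzZr fp !lorentz_lin !gramE; ring. Qed.
Let pk : lorentz p k = -1.
Proof. by rewrite lorentzDr lorentzZr pp pu2; ring. Qed.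
Let kk : lorentz k k = 0.
Proof. by rewrite lorentzDl lorentzZl pk lorentzDr lorentzZr (lorentzC u2 p) pu2 gramE;
  field. Qed.

Let frame := lorentz_frame ee ff ef ep fp ek fk pp kk pk.

Let frame_norm := lorentz_frame_norm ee ff ef ep fp ek fk pp kk pk.

Let u0E : u0 = - e. Proof. by rewrite opprK. Qed.
Let u1E : u1 = a *: p + e.
Proof. by rewrite /p /e scalerA divff ?gt_eqF// scale1r addrAC subrr add0r. Qed.
Let u2E : u2 = k - 2^-1 *: p. Proof. by rewrite /k addrK. Qed.
Let u4E : u4 = - f. Proof. by rewrite opprK. Qed.
Let u3E : u3 = b *: p + f.
Proof.
rewrite [LHS]frame.
have -> : lorentz u3 e = 0 by rewrite !lorentz_lin !gramE; ring.
have -> : lorentz u3 f = 1 by rewrite !lorentz_lin !gramE; ring.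
have -> : lorentz u3 p = 0 by rewrite !lorentz_lin !gramE; ring.
have -> : lorentz u3 k = - b by rewrite !lorentz_lin !gramE; ring.
by rewrite !scale0r scale1r scaleNr opprK add0r subr0 addrC.
Qed.

Let xu0 x : lorentz x u0 = - lorentz x e.
Proof. by rewrite {1}u0E lorentzNr. Qed.
Let xu1 x : lorentz x u1 = a * lorentz x p + lorentz x e.
Proof. by rewrite {1}u1E lorentzDr lorentzZr. Qed.
Let xu2 x : lorentz x u2 = lorentz x k - 2^-1 * lorentz x p.
Proof. by rewrite {1}u2E lorentzDr lorentzNr lorentzZr. Qed.
Let xu3 x : lorentz x u3 = b * lorentz x p + lorentz x f.
Proof. by rewrite {1}u3E lorentzDr lorentzZr. Qed.
Let xu4 x : lorentz x u4 = - lorentz x f.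
Proof. by rewrite {1}u4E lorentzNr. Qed.

Let pL : light_cone p.
Proof.
have [_ [x [xH xu]]] := ou.
apply: (light_cone_of_lorentz_lt0 xH pp).
rewrite lorentzZr pmulr_rlt0 ?invr_gt0// lorentzDr.
have := xu (@Ordinal 5 0 isT); have := xu (@Ordinal 5 1 isT); rewrite -/u0 -/u1; lra.
Qed.

Let all_faces (P : 'rV[R]_4 -> Prop) :
  (forall i, P (u i)) <-> [/\ P u0, P u1, P u2, P u3 & P u4].
Proof.
split; first by move=> h; split; apply: h.
move=> [h0 h1 h2 h3 h4] [[|[|[|[|[|//]]]]] i].
- by rewrite (_ : Ordinal i = @Ordinal 5 0 isT)//; apply/val_inj.
- by rewrite (_ : Ordinal i = @Ordinal 5 1 isT)//; apply/val_inj.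
- by rewrite (_ : Ordinal i = @Ordinal 5 2 isT)//; apply/val_inj.
- by rewrite (_ : Ordinal i = @Ordinal 5 3 isT)//; apply/val_inj.
- by rewrite (_ : Ordinal i = @Ordinal 5 4 isT)//; apply/val_inj.
Qed.

(** With X, Y, w the products with e, f, -p, the faces u0, u1, u3, u4 say that
0 <= X <= a w and 0 <= Y <= b w, and <x, x> = -1 turns the face u2 into
w^2 <= 1 + X^2 + Y^2, the exterior of the unit hemisphere. *)
Lemma polyhedron_horo_coord x : hyp3 x ->
  polyhedron u x <-> hemisphere_cusp a b (horo_coord p e f x).
Proof.
move=> xH; have w0 := lorentz_hyp3_light_cone xH pL.
have xx : lorentz x x = -1 by case: xH.
move: xx; rewrite (frame_norm x) => xx.
move: w0 xx; set X := lorentz x e; set Y := lorentz x f; set s := lorentz x k; set w :=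
  lorentz x p => w0 xx.
have w0' : 0 < - w by rewrite oppr_gt0.
rewrite /polyhedron/= (all_faces (fun n => lorentz x n <= 0)).
rewrite xu0 xu1 xu2 xu3 xu4 -/X -/Y -/s -/w.
rewrite /hemisphere_cusp /cusp/= /box/= !in_itv/= -/X -/Y -/w.
rewrite !ler_pdivlMr// !ler_pdivrMr// !mul0r.
have -> : (- w) ^+ 2 * (1 - (X / - w) ^+ 2 - (Y / - w) ^+ 2) = w ^+ 2 - X ^+ 2 - Y ^+ 2.
  by field; lra.
split.
- move=> [_ [h0 h1 h2 h3 h4]]; split; first (split; apply/andP; split; lra).
  have h : 0 <= (w - 2 * s) * - w by apply: mulr_ge0; lra.
  nra.
- move=> [[/andP[h0 h1] /andP[h2 h3]] h4]; split => //; split; try lra.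
  have h : 0 <= (w - 2 * s) * - w by nra.
  have : 0 <= w - 2 * s by move: h; rewrite pmulr_lge0.
  lra.
Qed.

Lemma hyp3_vol_polyhedron :
  hyp3_vol (polyhedron u) = horo_volume (hemisphere_cusp a b).
Proof.
rewrite (eq_hyp3_vol (B := [set x | hemisphere_cusp a b (horo_coord p e f x)])).
  rewrite hyp3_vol_horospherical//; first by case: pL.
  exact: measurable_hemisphere_cusp.
exact: polyhedron_horo_coord.
Qed.

Let pu0 : lorentz p u0 = 0. Proof. by rewrite xu0 lorentzC ep oppr0. Qed.
Let pu1 : lorentz p u1 = 0. Proof. by rewrite xu1 pp lorentzC ep; ring. Qed.
Let pu3 : lorentz p u3 = 0. Proof. by rewrite xu3 pp lorentzC fp; ring. Qed.
Let pu4 : lorentz p u4 = 0. Proof. by rewrite xu4 lorentzC fp oppr0. Qed.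

(** The vector on the ray of the vertex u0, u1, u3, u4 whose horosphere touches
u2: its product with u2 is -1. *)
Definition parallel_vertex : 'rV[R]_4 := p.

Lemma ideal_vertex_parallel : ideal_vertex u parallel_vertex.
Proof.
split => //.
- apply/(all_faces (fun n => lorentz p n <= 0)).
  by rewrite pu0 pu1 pu2 pu3 pu4 lerN10; split.
- move=> x /(all_faces (fun n => lorentz p n = 0 -> lorentz x n = 0)).
  move=> [/(_ pu0) h0 /(_ pu1) h1 _ /(_ pu3) h3 /(_ pu4) h4].
  exists (- lorentz x k).
  have xe : lorentz x e = 0 by move: h0; rewrite xu0 => /eqP; rewrite oppr_eq0 => /eqP.
  have xf : lorentz x f = 0 by move: h4; rewrite xu4 => /eqP; rewrite oppr_eq0 => /eqP.
  have xp : lorentz x p = 0.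
    move: h1; rewrite xu1 xe addr0 => /eqP; rewrite mulf_eq0 gt_eqF//= => /eqP //.
  by rewrite {1}(frame x) xe xf xp !scale0r !add0r subr0 scaleNr.
Qed.

Lemma admissible_parallel : admissible u parallel_vertex.
Proof.
apply/(all_faces (fun n => lorentz p n != 0 -> horoball p `<=` [set x | lorentz x n <= 0])).
rewrite pu0 pu1 pu3 pu4 eqxx; split => // _ x [xH xp] /=.
have w0 := lorentz_hyp3_light_cone xH pL.
have xx : lorentz x x = -1 by case: xH.
move: xx; rewrite (frame_norm x) xu2.
set X := lorentz x e; set Y := lorentz x f; set s := lorentz x k.
move: w0 xp; set w := lorentz x p => w0 w1 xx.
have h : 1 <= 2 * (w * s) by nra.
have : 2 * s <= w by nra.
lra.
Qed.

(** The horoball is z >= 1, which lies above the hemisphere: only the rectangle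
bounds the intersection. *)
Lemma hyp3_vol_parallel :
  hyp3_vol (horoball parallel_vertex `&` polyhedron u) = (a * b / 2)%:E.
Proof.
rewrite -horo_volume_box//.
transitivity (hyp3_vol [set x | cusp (box a b) (fun=> 1) (horo_coord p e f x)]); last first.
  rewrite hyp3_vol_horospherical//; first by case: pL.
  by apply: measurable_cusp => //; exact: measurable_box.
apply: eq_hyp3_vol => x xH; rewrite /parallel_vertex.
have w0 := lorentz_hyp3_light_cone xH pL.
have hw : (- lorentz x p) ^+ 2 * 1 <= 1 <-> -1 <= lorentz x p by split; nra.
split.
- move=> [[_ hp] /(polyhedron_horo_coord xH) [hb _]]; split => //.
  exact/hw.
- move=> [hb /hw hp]; split; first by split.
  apply/(polyhedron_horo_coord xH); split => //=.
  have := sqr_ge0 (lorentz x e / - lorentz x p).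
  have := sqr_ge0 (lorentz x f / - lorentz x p).
  move: ((lorentz x e / - lorentz x p) ^+ 2) ((lorentz x f / - lorentz x p) ^+ 2) => A B A0 B0.
  nra.
Qed.

(** Null when a^2 + b^2 = 1: it then spans the vertex common to u1, u2, u3. *)
Let N := u2 + a *: u1 + b *: u3.

(** A null vector v in the closed polyhedron, with coordinates X, Y, s, w in the
frame, satisfies X^2 + Y^2 = 2 w s >= w^2, while X <= a |w| and Y <= b |w|.  So
either w = 0, which leaves only the ray of p, or a^2 + b^2 = 1 and equality holds
throughout. *)
Lemma ideal_vertex_cases v : ideal_vertex u v ->
  (exists t, 0 < t /\ v = t *: p) \/
  (exists t, [/\ 0 < t, a ^+ 2 + b ^+ 2 = 1 & v = t *: N]).
Proof.
move=> [vL /(all_faces (fun n => lorentz v n <= 0)) [h0 h1 h2 h3 h4] _].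
move: h0 h1 h2 h3 h4; rewrite xu0 xu1 xu2 xu3 xu4.
have vv : lorentz v v = 0 by case: vL.
move: vv (frame v); rewrite (frame_norm v).
set X := lorentz v e; set Y := lorentz v f; set s := lorentz v k; set w := lorentz v p.
move=> vv vE h0 h1 h2 h3 h4.
have vt : 0 < time v by case: vL.
have pt : 0 < time p by case: pL.
have w_le0 : w <= 0 by rewrite -(pmulr_rle0 _ a_gt0); lra.
have [w0|w_lt0] := eqVneq w 0.
  left; exists (- s).
  have vE' : v = (- s) *: p.
    have X0 : X = 0 by apply/le_anti; rewrite w0 in h1; apply/andP; split; lra.
    have Y0 : Y = 0 by apply/le_anti; rewrite w0 in h3; apply/andP; split; lra.
    by rewrite vE X0 Y0 w0 !scale0r !add0r subr0 scaleNr.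
  split => //; move: vt; rewrite vE' /time mxE -/(time p) => vt.
  by rewrite -(pmulr_lgt0 _ pt).
have W0 : 0 < - w by rewrite oppr_gt0 lt_neqAle w_lt0.
have X2 : X ^+ 2 <= a ^+ 2 * w ^+ 2.
  by rewrite -exprMn -[leRHS]sqrrN -mulrN ler_pXn2r ?nnegrE//; nra.
have Y2 : Y ^+ 2 <= b ^+ 2 * w ^+ 2.
  by rewrite -exprMn -[leRHS]sqrrN -mulrN ler_pXn2r ?nnegrE//; nra.
have w2 : 0 < w ^+ 2 by rewrite -sqrrN exprn_gt0.
have ws : w ^+ 2 <= 2 * (w * s).
  have : 0 <= (w - 2 * s) * - w by apply: mulr_ge0; lra.
  nra.
have abw : (a ^+ 2 + b ^+ 2) * w ^+ 2 <= w ^+ 2 by rewrite ger_pMl.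
have ab1 : a ^+ 2 + b ^+ 2 = 1.
  by apply/le_anti; rewrite ab_le/= -(ler_pM2r w2) mul1r; lra.
have XE : X = a * - w.
  apply/le_anti; apply/andP; split; first lra.
  have aw : a * - w \is Num.nneg by rewrite nnegrE mulr_ge0// ltW.
  by rewrite -(ler_pXn2r (n := 2))// ?nnegrE//; nra.
have YE : Y = b * - w.
  apply/le_anti; apply/andP; split; first lra.
  have bw : b * - w \is Num.nneg by rewrite nnegrE mulr_ge0// ltW.
  by rewrite -(ler_pXn2r (n := 2))// ?nnegrE//; nra.
have sE : s = w / 2.
  apply: (@mulfI _ w) => //; nra.
right; exists (- w); split => //.
by rewrite vE XE YE sE /N {1}u1E {1}u2E {1}u3E; exact: null_combination.
Qed.

Let face_distance v i : admissible u v -> light_cone v -> lorentz v (u i) < 0 ->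
  lorentz (u i) (u i) = 1 -> lorentz v (u i) <= -1.
Proof.
move=> adm vL vi ii; apply: horoball_halfspace => //.
by apply: adm; rewrite lt_eqF.
Qed.

(** With v = t N at infinity, the faces u1, u3, u2 bound a right triangle with
legs 1 / (t a), 1 / (t b), and the horoball is z >= 1; admissibility with respect
to u0 and u4 says that t a >= 1 and t b >= 1. *)
Let hyp3_vol_horoball_finite_le v t : 0 < t -> a ^+ 2 + b ^+ 2 = 1 -> v = t *: N ->
  light_cone v -> admissible u v ->
  (hyp3_vol (horoball v `&` polyhedron u) <= (a * b / 2)%:E)%E.
Proof.
move=> t0 ab1 vE vL adm.
have vN x : lorentz x v = t * (lorentz x u2 + a * lorentz x u1 + b * lorentz x u3).
  by rewrite vE /N lorentzZr !lorentzDr !lorentzZr.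
have ta : 1 <= t * a.
  have v0 : lorentz v u0 = - (t * a) by rewrite lorentzC vN !gramE; ring.
  have := face_distance (i := Ordinal (isT : 0 < 5)%N) adm vL; rewrite -/u0 v0 g00 => h.
  have : 0 < t * a by rewrite mulr_gt0.
  lra.
have tb : 1 <= t * b.
  have v4 : lorentz v u4 = - (t * b) by rewrite lorentzC vN !gramE; ring.
  have := face_distance (i := Ordinal (isT : 4 < 5)%N) adm vL; rewrite -/u4 v4 g44 => h.
  have : 0 < t * b by rewrite mulr_gt0.
  lra.
pose E := cusp (triangle a b t^-1) (fun=> 1).
have mE : measurable E by apply: measurable_cusp => //; exact: measurable_triangle.
apply: (@le_trans _ _ (horo_volume E)); last first.
  rewrite horo_volume_triangle ?invr_gt0// lee_fin ler_pdivrMr ?mulr_gt0//.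
  have -> : t^-1 ^+ 2 = (t ^+ 2)^-1 by rewrite exprVn.
  rewrite -[leLHS]div1r ler_pdivrMr ?exprn_gt0//.
  have -> : a * b / 2 * (4 * a * b) * t ^+ 2 = 2 * (t * a) ^+ 2 * b ^+ 2 by field.
  have A2 : 1 <= (t * a) ^+ 2 by rewrite exprn_ege1.
  have B2 : 1 <= (t * b) ^+ 2 by rewrite exprn_ege1.
  (* as a^2 + b^2 = 1, one of the two squares is at least 1/2 *)
  have [hb|hb] := leP 2^-1 (b ^+ 2); first nra.
  have -> : 2 * (t * a) ^+ 2 * b ^+ 2 = 2 * (t * b) ^+ 2 * a ^+ 2 by ring.
  have : 2^-1 <= a ^+ 2 by lra.
  nra.
(* u1 and u3 meet at a right angle and pass through v: they give the frame *)
apply: (@le_trans _ _ (hyp3_vol [set x | E (horo_coord v (- u1) (- u3) x)])); last first.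
  have -> : horo_volume E = hyp3_vol [set x | E (horo_coord v (- u1) (- u3) x)] => //.
  rewrite hyp3_vol_horospherical//.
  - by case: vL.
  - by case: vL.
  - by rewrite lorentzNl lorentzNr opprK.
  - by rewrite lorentzNl lorentzNr opprK.
  - by rewrite lorentzNl lorentzNr opprK.
  - by rewrite lorentzNl vN !gramE; ring.
  - by rewrite lorentzNl vN !gramE; ring.
apply: le_hyp3_vol.
- exact: measurable_horoball_polyhedron.
- exact: measurable_horo_coord.
move=> x xH [[_ xv]] [_ /(all_faces (fun n => lorentz x n <= 0)) [_ h1 h2 h3 _]].
have w0 := lorentz_hyp3_light_cone xH vL.
rewrite /E /cusp /triangle/= !lorentzNr; split.
  have W0 : 0 < - lorentz x v by rewrite oppr_gt0.
  rewrite !ler_pdivlMr// !mul0r !oppr_ge0; split => //.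
  rewrite !mulrA -mulrDl ler_pdivrMr// ler_pdivlMl//.
  by rewrite vN; nra.
by rewrite mulr1; nra.
Qed.

(** At the parallel vertex, admissibility with respect to u2 places the horoball
inside the one of parallel_vertex, whose volume is known. *)
Lemma hyp3_vol_horoball_le v : ideal_vertex u v -> admissible u v ->
  (hyp3_vol (horoball v `&` polyhedron u) <= (a * b / 2)%:E)%E.
Proof.
move=> iv adm; have vL : light_cone v by case: iv.
have [[t [t0 vE]]|[t [t0 ab1 vE]]] := ideal_vertex_cases iv; last first.
  exact: hyp3_vol_horoball_finite_le ab1 vE vL adm.
have t1 : 1 <= t.
  have v2 : lorentz v u2 = - t by rewrite vE lorentzZl pu2 mulrN1.
  have := face_distance (i := Ordinal (isT : 2 < 5)%N) adm vL; rewrite -/u2 v2 g22 => h.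
  lra.
rewrite -hyp3_vol_parallel; apply: le_hyp3_vol.
- exact: measurable_horoball_polyhedron.
- exact: measurable_horoball_polyhedron.
move=> x xH [[_ xv] xu]; split => //; split => //.
have w0 := lorentz_hyp3_light_cone xH pL.
rewrite /parallel_vertex; move: xv; rewrite vE lorentzZr; nra.
Qed.

End truncated_orthoscheme.

(** * Angles, and comparison of densities *)

Section density.
Context {R : realType}.

(** The triple angle formula at pi / 3 gives (c + 1) (2 c - 1)^2 = 0. *)
Lemma cos_pi_div3 : cos (pi / 3%:R) = 2^-1 :> R.
Proof.
set t : R := pi / 3%:R.
have p0 := pi_gt0 R.
have t3 : t *+ 2 + t = pi by rewrite /t; field.
have : cos (t *+ 2 + t) = -1 by rewrite t3 cospi.
rewrite cosD cos_mulr2n sin_mulr2n => h.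
have c0 : 0 < cos t by apply: cos_gt0_pihalf; rewrite /t; apply/andP; split; lra.
have s2 : sin t ^+ 2 = 1 - cos t ^+ 2 by rewrite -(cos2Dsin2 t); ring.
have : (cos t + 1) * (2 * cos t - 1) ^+ 2 = 0.
  transitivity ((cos t ^+ 2 *+ 2 - 1) * cos t - (cos t * sin t) *+ 2 * sin t + 1).
    rewrite (_ : _ *+ 2 * sin t = 2 * cos t * sin t ^+ 2); last by ring.
    by rewrite s2; ring.
  by rewrite h; ring.
move=> /eqP; rewrite mulf_eq0 expf_eq0/= => /orP[/eqP|/eqP]; lra.
Qed.

Let pi_div_in (q : nat) : (3 <= q)%N -> 0 <= (pi : R) / q%:R <= pi.
Proof.
move=> q3; have p0 := pi_gt0 R; have q0 : (0 : R) < q%:R by rewrite ltr0n; apply: leq_trans q3.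
apply/andP; split; first by rewrite divr_ge0// ltW.
rewrite ler_pdivrMr// ler_peMr ?(ltW p0)// ler1n.
exact: leq_trans q3.
Qed.

Lemma cos_pi_div_ge_half (q : nat) : (3 <= q)%N -> 2^-1 <= cos (pi / q%:R) :> R.
Proof.
move=> q3; rewrite -cos_pi_div3 leNgt ltr_cos ?in_itv/= ?pi_div_in// -leNgt.
rewrite ler_pM2l ?pi_gt0// lef_pV2 ?posrE ?ltr0n ?ler_nat//.
exact: leq_trans q3.
Qed.

(** The hypothesis says that pi / q + pi / r >= pi / 2; then
cos (pi / r) <= sin (pi / q). *)
Lemma cos_pi_div_sqr (q r : nat) : (3 <= q)%N -> (3 <= r)%N -> (q * r <= 2 * (q + r))%N ->
  cos (pi / q%:R) ^+ 2 + cos (pi / r%:R) ^+ 2 <= 1 :> R.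
Proof.
move=> q3 r3 qr; have p0 := pi_gt0 R.
have q0 : (0 : R) < q%:R by rewrite ltr0n; apply: leq_trans q3.
have r0 : (0 : R) < r%:R by rewrite ltr0n; apply: leq_trans r3.
have q3' : (3 : R) <= q%:R by rewrite ler_nat.
have qle : pi / q%:R <= pi / 3 :> R by rewrite ler_pM2l// lef_pV2 ?posrE.
have /andP[q1 q2] := pi_div_in q3.
rewrite -lerBrDl -sin2cos2 ler_pXn2r ?nnegrE//; last 2 first.
- by apply: le_trans (cos_pi_div_ge_half r3); rewrite invr_ge0.
- by rewrite sin_ge0_pi// pi_div_in.
rewrite -cosBpihalf -[leRHS]cosN opprB leNgt ltr_cos ?in_itv/= ?pi_div_in//;
  last by apply/andP; split; lra.
rewrite -leNgt lerBlDr.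
have -> : pi / r%:R + pi / q%:R = pi * ((q%:R + r%:R) / (q%:R * r%:R)) :> R.
  by field; rewrite !gt_eqF.
rewrite ler_pM2l// ler_pdivlMr ?mulr_gt0// -natrM -natrD mulrC ler_pdivrMr//.
by rewrite mulrC -natrM ler_nat.
Qed.

(** Coordinates in which e and f are the second and third basis vectors and the
parallel vertex is (1, 0, 0, 1). *)
Definition regular_normals (k : 'I_5) : 'rV[R]_4 :=
  \row_(j < 4) nth 0 (nth [::]
    [:: [:: 0;    -1;  0; 0];
        [:: 2^-1;  1;  0; 2^-1];
        [:: 0;     0;  0; -1];
        [:: 2^-1;  0;  1; 2^-1];
        [:: 0;     0; -1; 0]] k) j.

Lemma orthoscheme_regular : orthoscheme 3 3 regular_normals.
Proof.
split.
  move=> i j; rewrite /gram mxE /gram_table cos_pi_div3 lorentzE /dot3 /space /time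
    /regular_normals !mxE.
  case: i => [[|[|[|[|[|//]]]]] ?]; case: j => [[|[|[|[|[|//]]]]] ?]; rewrite /=; lra.
(* the point with horizontal coordinates 1/4, 1/4 and height 2 *)
pose x : 'rV[R]_4 := \row_(j < 4) nth 0 [:: 41%:R / 32%:R; 8%:R^-1; 8%:R^-1; 25%:R / 32%:R] j.
exists x; split.
  split; last by rewrite mxE/=; lra.
  by rewrite lorentzE /dot3 /space /time !mxE/=; field.
move=> i; rewrite lorentzE /dot3 /space /time !mxE/=.
case: i => [[|[|[|[|[|//]]]]] ?]; rewrite /=; lra.
Qed.

(** The volume of the orthoscheme for (3, 3). *)
Definition least_volume : \bar R := horo_volume (hemisphere_cusp 2^-1 2^-1).

Lemma least_volume_bounds : exists v : R, [/\ least_volume = v%:E,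
  ((3053%:R * 1000%:R + 218%:R) * 1000%:R + 643%:R) / 10%:R ^+ 10 <= 2 * v &
  2 * v <= (3053%:R * 1000%:R + 219%:R) / 10%:R ^+ 7].
Proof.
have /andP[lo up] := @horo_volume_hemisphere_bounds R 22 _ erefl.
have [h1 h2] := @radial_bounds R.
rewrite /least_volume; move: lo up.
case: (horo_volume _) => [v||]; rewrite ?lee_fin ?leNye ?leye_eq// => lo up.
by exists v; split => //; lra.
Qed.

(** The volume V of the polyhedron is at least 4 a b v, and the horoball takes at
most a b / 2 of it, so the ratio is at most 1 / (8 v). *)
Lemma packing_density_le (q r : nat) (u : 'I_5 -> 'rV[R]_4) (p : 'rV[R]_4) (v : R) :
  least_volume = v%:E -> 0 < v ->
  2^-1 <= cos (pi / q%:R) :> R -> 2^-1 <= cos (pi / r%:R) :> R ->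
  cos (pi / q%:R) ^+ 2 + cos (pi / r%:R) ^+ 2 <= 1 :> R ->
  orthoscheme q r u -> ideal_vertex u p -> admissible u p ->
  packing_density u p <= (8 * v)^-1.
Proof.
set a : R := cos _; set b : R := cos _ => vE v0 ha hb hab ou ip ap.
have a0 : 0 < a by lra.
have b0 : 0 < b by lra.
have B := @hyp3_vol_horoball_le R q r u a b erefl erefl ha hb hab ou p ip ap.
have P := hyp3_vol_polyhedron erefl erefl ha ou.
have S := horo_volume_hemisphere_scale ha hb.
rewrite /packing_density -P -/least_volume vE in S *.
have B0 : (0 <= hyp3_vol (horoball p `&` polyhedron u))%E.
  by apply: integral_ge0 => y _; rewrite lee_fin invr_ge0 sqrtr_ge0.
move: (hyp3_vol (horoball p `&` polyhedron u)) (hyp3_vol (polyhedron u)) B B0 S {P}.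
move=> [s||//] //; rewrite !lee_fin => V hs s0 hV.
have d0 : 0 <= (8 * v)^-1 by rewrite invr_ge0 mulr_ge0// ltW.
have k0 : 0 < (4 * a * b)^-1 by rewrite invr_gt0 !mulr_gt0.
(* an infinite value of V is read as 0, which makes the ratio 0 *)
case: V hV => [V||] hV /=; rewrite ?invr0 ?mulr0//.
rewrite -EFinM lee_fin ler_pdivlMl ?mulr_gt0// in hV.
have V0 : 0 < V by apply: lt_le_trans hV; rewrite !mulr_gt0.
rewrite ler_pdivrMr// ler_pdivlMl ?mulr_gt0//.
nra.
Qed.

Lemma packing_density_regular (v : R) : least_volume = v%:E -> 0 < v ->
  packing_density regular_normals (parallel_vertex regular_normals 2^-1) = (8 * v)^-1.
Proof.
move=> vE v0.
have h : 2^-1 <= 2^-1 :> R by [].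
have P := hyp3_vol_polyhedron cos_pi_div3 cos_pi_div3 h orthoscheme_regular.
have B := hyp3_vol_parallel cos_pi_div3 cos_pi_div3 h h orthoscheme_regular.
rewrite /packing_density P B -/least_volume vE/=.
by field; rewrite gt_eqF.
Qed.

Lemma inverse_rounding (v : R) :
  ((3053%:R * 1000%:R + 218%:R) * 1000%:R + 643%:R) / 10%:R ^+ 10 <= 2 * v ->
  2 * v <= (3053%:R * 1000%:R + 219%:R) / 10%:R ^+ 7 ->
  `|(8 * v)^-1 - 8188080%:R / 10%:R ^+ 7| <= (2%:R * 10%:R ^+ 7)^-1.
Proof.
move=> lo up.
have V : 0 < 8 * v by lra.
(* in groups of three digits, as in the hypotheses *)
have -> : 8188080%:R = (8188%:R * 1000%:R + 80%:R) :> R by ring.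
have dV : (8 * v)^-1 * (8 * v) = 1 by rewrite mulVf ?gt_eqF.
move: dV; move: ((8 * v)^-1) => d dV.
rewrite ler_norml; apply/andP; split.
  by rewrite lerBrDl -(ler_pM2r V) dV; lra.
by rewrite lerBlDl -(ler_pM2r V) dV; lra.
Qed.

End density.

Theorem theorem4p2 (R : realType) :
  exists (P : set (set 'rV[R]_4)) (d : R),
    [/\ horoball_packing 3 3 P d,
        forall (q r : nat) (P' : set (set 'rV[R]_4)) (d' : R),
          (q, r) \in orthoscheme_pairs ->
          horoball_packing q r P' d' -> d' <= d &
        `|d - 8188080%:R / 10%:R ^+ 7| <= (2%:R * 10%:R ^+ 7)^-1].
Proof.
have [v [vE lo up]] := @least_volume_bounds R.
have v0 : 0 < v by lra.
pose u := @regular_normals R.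
pose p := parallel_vertex u 2^-1.
have h : 2^-1 <= 2^-1 :> R by [].
exists (horoball_images u p), (8 * v)^-1; split.
- exists u, p; split => //.
  + exact: orthoscheme_regular.
  + exact (ideal_vertex_parallel cos_pi_div3 cos_pi_div3 h orthoscheme_regular).
  + exact (admissible_parallel cos_pi_div3 cos_pi_div3 h orthoscheme_regular).
  + by rewrite (packing_density_regular vE v0).
- move=> q r P' d' qr [u' [p' [ou ip ap _ ->]]].
  have /andP[q3 /andP[r3 qr2]] : [&& (3 <= q)%N, (3 <= r)%N & (q * r <= 2 * (q + r))%N].
    move: qr; rewrite /orthoscheme_pairs !inE !xpair_eqE.
    by do ![case/orP]; case/andP => /eqP -> /eqP ->.
  apply: packing_density_le ou ip ap => //.
  + exact: cos_pi_div_ge_half.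
  + exact: cos_pi_div_ge_half.
  + exact: cos_pi_div_sqr.
- exact: inverse_rounding.
Qed.
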